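(* Suppose $I \leq \omega$ and $\{\Gamma_i\}_{i \in I}$ is a set of countable discrete groups, and let $\ast_i \Gamma_i$ denote their free product. Let $\{A_i\}_{i \in I}$ be a Borel partition of $(2^\omega)^{\ast_i \Gamma_i}$. Then there exist some $j \in I$ and an injective continuous function $f \colon (2^\omega)^{\Gamma_j} \to (2^\omega)^{\ast_i \Gamma_i}$ that is $\Gamma_j$-equivariant with respect to the shift actions, and such that $\operatorname{ran}(f) \subseteq A_j$. Furthermore, $f$ can be chosen to be a Borel reduction between the orbit equivalence relations induced by the shift actions of $\Gamma_j$ on $(2^\omega)^{\Gamma_j}$ and of $\ast_i \Gamma_i$ on $(2^\omega)^{\ast_i \Gamma_i}$.
   Context: $I \le \omega$ means that $I$ is a natural number (viewed as $\{0,\dots,I-1\}$) or $I=\omega$. For a countable discrete group $\Gamma$ and a Polish space $X$, $\Gamma$ acts on the Polish space $X^\Gamma$ (product topology) by the left shift action $(\gamma \cdot x)(\delta) = x(\gamma^{-1}\delta)$. Each $\Gamma_j$ is viewed as a subgroup of $\ast_i \Gamma_i$ and so acts on $(2^\omega)^{\ast_i \Gamma_i}$; $f$ is $\Gamma_j$-equivariant if $f(\gamma \cdot x) = \gamma \cdot f(x)$ for all $\gamma \in \Gamma_j$ and all $x$. A Borel reduction from an equivalence relation $E$ on $X$ to $F$ on $Y$ is a Borel $f \colon X \to Y$ with $x \mathrel{E} y \iff f(x) \mathrel{F} f(y)$. *)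

(* Defs.v *)
From HB Require Import structures.
From mathcomp Require Import all_boot all_order all_algebra.
From mathcomp Require Import all_classical all_reals all_analysis.

Set Implicit Arguments.
Unset Strict Implicit.
Unset Printing Implicit Defensive.

Local Open Scope classical_set_scope.
Local Open Scope group_scope.

(* The free product of a family of groups, realised as the set of reduced
   words: finite sequences of nontrivial letters (i, g), g in G i, in which
   consecutive letters come from different factors. *)
Section FreeProduct.
Context {I : choiceType} (G : I -> groupType).

Local Notation letter := {i : I & G i}.

Implicit Types (a b c : letter) (u v w : seq letter).

Definition nontrivial a := tagged a != 1.

Definition reduced w :=
  all nontrivial w && sorted (fun a b => tag a != tag b) w.

Record free_product := FreeProduct { word :> seq letter; _ : reduced word }.

HB.instance Definition _ := [isSub for word].
HB.instance Definition _ := [Choice of free_product by <:].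

Definition lmul a w : seq letter :=
  if tagged a == 1 then w else
  if w is b :: w' then
    if tag a == tag b then
      let g := tagged a * tagged_as a b in
      if g == 1 then w' else Tagged (fun i => G i : Type) g :: w'
    else a :: w
  else [:: a].

Definition wmul u v := foldr lmul v u.

Definition linv a : letter := Tagged (fun i => G i : Type) (tagged a)^-1.

Definition winv u := rev (map linv u).

Lemma reduced_cons a w : reduced (a :: w) =
  [&& nontrivial a, (if w is b :: _ then tag a != tag b else true) & reduced w].
Proof.
rewrite /reduced /=; case: w => [|b w] /=; first by rewrite !andbT.
by case: (nontrivial a); case: (nontrivial b); case: (all _ w);
  case: (tag a != tag b).
Qed.

Lemma reduced_lmul a w : reduced w -> reduced (lmul a w).
Proof.
rewrite /lmul; case: ifPn => [//|a1] rw.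
case: w rw => [|b w] rw; first by rewrite reduced_cons /nontrivial a1.
case: ifPn => [tab|tab]; last by rewrite reduced_cons /nontrivial a1 tab.
move: rw; rewrite reduced_cons => /and3P[_ hb rw].
case: ifPn => [//|g1]; rewrite reduced_cons /nontrivial /= g1 rw andbT /=.
by case: w hb {rw} => // c w; rewrite (eqP tab).
Qed.

Lemma reduced_wmul u v : reduced v -> reduced (wmul u v).
Proof. by move=> rv; elim: u => //= a u; exact: reduced_lmul. Qed.

Lemma lmulA i (g h : G i) w : reduced w ->
  lmul (Tagged (fun i => G i : Type) g) (lmul (Tagged (fun i => G i : Type) h) w)
  = lmul (Tagged (fun i => G i : Type) (g * h)) w.
Proof.
rewrite {2}/lmul /=; case: (eqVneq h 1) => [->|h1] rw; first by rewrite mulg1.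
case: w rw => [|[j k] w] rw.
  rewrite /lmul /= eqxx tagged_asE; case: (eqVneq g 1) => [->|g1].
    by rewrite mul1g (negbTE h1).
  by [].
rewrite /=; case: (eqVneq i j) => [eij|nij].
  subst j; rewrite !tagged_asE.
  move: rw; rewrite reduced_cons => /and3P[/= k1 hw rw].
  case: (eqVneq (h * k) 1) => [hk1|hk1].
    rewrite {2}/lmul /= eqxx tagged_asE -mulgA hk1 mulg1.
    case: (eqVneq g 1) => [g1|g1].
      rewrite g1 mul1g (negbTE h1).
      by rewrite /lmul /= eqxx.
    case: (eqVneq (g * h) 1) => [gh1|gh1].
      rewrite /lmul /= (negbTE g1).
      have <- : k = g.
        by rewrite -[k]mul1g -gh1 -mulgA hk1 mulg1.
      case: w hw {rw} => [//|[l m] w] /= hw.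
      by rewrite (negbTE hw).
    rewrite /lmul /= (negbTE g1).
    case: w hw {rw} => [//|[l m] w] /= hw.
    by rewrite (negbTE hw).
  rewrite /lmul /= eqxx !tagged_asE mulgA.
  case: (eqVneq g 1) => [g1|g1].
    by rewrite g1 !mul1g (negbTE h1) (negbTE hk1).
  case: (eqVneq (g * h) 1) => [gh1|gh1]; last by [].
  by rewrite gh1 mul1g (negbTE k1).
rewrite /lmul /= eqxx tagged_asE (negbTE nij).
by case: (eqVneq g 1) => [->|//]; rewrite mul1g (negbTE h1).
Qed.

Lemma lmul_reduced a u : reduced (a :: u) -> lmul a u = a :: u.
Proof.
rewrite reduced_cons /lmul => /and3P[/negbTE -> h _].
by case: u h => // b u /negbTE ->.
Qed.

Lemma wmulw0 u : reduced u -> wmul u [::] = u.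
Proof.
elim: u => //= a u IH ru.
by rewrite IH ?lmul_reduced //; move: ru; rewrite reduced_cons => /and3P[].
Qed.

Lemma wmul_lmul a u v : reduced u -> reduced v ->
  wmul (lmul a u) v = lmul a (wmul u v).
Proof.
move=> ru rv; rewrite {1}/lmul; case: ifPn => [a1|a1].
  by rewrite /lmul a1.
case: u ru => [//|b u] ru; case: ifPn => //= tab.
move: a b a1 tab ru => [i g] [j h] /= g1 /eqP ij; subst j.
rewrite tagged_asE reduced_cons => /and3P[_ _ ru].
rewrite lmulA ?reduced_wmul //.
by case: eqVneq => [->|//]; rewrite {1}/lmul eqxx.
Qed.

Lemma wmulA u v w : reduced u -> reduced v -> reduced w ->
  wmul u (wmul v w) = wmul (wmul u v) w.
Proof.
move=> + rv rw; elim: u => //= a u IH.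
rewrite reduced_cons => /and3P[_ _ ru].
by rewrite wmul_lmul ?reduced_wmul // IH.
Qed.

Lemma reduced_winv u : reduced u -> reduced (winv u).
Proof.
move=> /andP[/allP nu su]; apply/andP; split.
  apply/allP => a; rewrite mem_rev => /mapP[b /nu bu ->].
  by rewrite /nontrivial /= invg_eq1.
rewrite rev_sorted sorted_map.
by apply: sub_sorted su => a b /=; rewrite eq_sym.
Qed.

Lemma wmulVw u v : reduced u -> reduced v -> wmul (winv u) (wmul u v) = v.
Proof.
move=> + rv; elim: u => //= a u IH.
rewrite reduced_cons => /and3P[_ _ ru].
rewrite /winv /= rev_cons /wmul foldr_rcons -/(wmul u v).
case: a => i g; rewrite lmulA ?reduced_wmul //= mulVg.
by rewrite [X in foldr _ X _]/lmul /= eqxx; exact: IH.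
Qed.

Lemma winvK u : winv (winv u) = u.
Proof.
rewrite /winv map_rev revK -map_comp -[RHS]map_id; apply: eq_map => -[i g] /=.
by rewrite /linv /= invgK.
Qed.

Definition fp_mul (x y : free_product) : free_product :=
  FreeProduct (reduced_wmul x (valP y)).

Definition fp_one : free_product := @FreeProduct [::] isT.

Definition fp_inv (x : free_product) : free_product :=
  FreeProduct (reduced_winv (valP x)).

Fact fp_mulA : associative fp_mul.
Proof. by move=> x y z; apply: val_inj; apply: wmulA; exact: valP. Qed.

Fact fp_mul1g : left_id fp_one fp_mul.
Proof. by move=> x; exact: val_inj. Qed.

Fact fp_mulg1 : right_id fp_one fp_mul.
Proof. by move=> x; apply: val_inj; apply: wmulw0; exact: valP. Qed.

Fact fp_mulVg : left_inverse fp_one fp_inv fp_mul.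
Proof.
move=> x; apply: val_inj => /=.
by rewrite -[in X in wmul _ X](wmulw0 (valP x)) wmulVw //; exact: valP.
Qed.

Fact fp_mulgV : right_inverse fp_one fp_inv fp_mul.
Proof.
move=> x; rewrite -{1}[x](_ : fp_inv (fp_inv x) = x) ?fp_mulVg //.
by apply: val_inj; exact: winvK.
Qed.

HB.instance Definition _ := isGroup.Build free_product
  fp_mulA fp_mul1g fp_mulg1 fp_mulVg fp_mulgV.

Fact reduced_fp_in i (g : G i) :
  reduced (lmul (Tagged (fun i => G i : Type) g) [::]).
Proof. exact: reduced_lmul. Qed.

Definition fp_in i (g : G i) : free_product := FreeProduct (reduced_fp_in g).

Lemma fp_inM i : {morph @fp_in i : g h / g * h}.
Proof.
move=> g h; apply: val_inj => /=; rewrite -lmulA //.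
by rewrite [in RHS]/lmul /=; case: eqVneq => [->|//]; rewrite {1}/lmul /= eqxx.
Qed.

HB.instance Definition _ i := isMultiplicative.Build (G i) free_product
  (@fp_in i) (@fp_inM i).

Lemma fp_in_inj i : injective (@fp_in i).
Proof.
move=> g h /(congr1 val); rewrite /= /lmul /=.
case: (eqVneq g 1) => [->|g1]; case: (eqVneq h 1) => [->|h1] //.
by case=> /eqP; rewrite eq_Tagged => /eqP.
Qed.

Lemma free_productP (H : groupType) (phi : forall i, G i -> H)
    (phiM : forall i, {morph phi i : g h / g * h}) :
  exists! psi : free_product -> H,
    {morph psi : x y / x * y} /\ forall i g, psi (@fp_in i g) = phi i g.
Proof.
have phi1 i : phi i 1 = 1.
  by apply: (@mulgI _ (phi i 1)); rewrite -phiM !mulg1.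
pose ev w : H := foldr (fun a z => phi (tag a) (tagged a) * z) 1 w.
have evl a w : ev (lmul a w) = phi (tag a) (tagged a) * ev w.
  rewrite /lmul; case: eqVneq => [->|a1]; first by rewrite phi1 mul1g.
  case: w => [//|b w]; case: eqVneq => // tab.
  case: a b a1 tab => [i g] [j h] /= g1 ij; subst j; rewrite tagged_asE.
  rewrite mulgA -phiM; case: eqVneq => [->|//].
  by rewrite phi1 mul1g.
have evM u v : ev (wmul u v) = ev u * ev v.
  elim: u => [|a u IH] /=; first by rewrite mul1g.
  by rewrite evl IH mulgA.
exists (fun x => ev (word x)); split.
  split=> [x y|i g]; first exact: evM.
  by rewrite /= evl /= mulg1.
move=> psi [psiM psiE]; apply/funext => x.
have psi1 : psi 1 = 1 by apply: (@mulgI _ (psi 1)); rewrite -psiM !mulg1.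
case: x => w; elim: w => [|a w IH] rw.
  by rewrite [LHS]/= -[LHS]psi1; congr psi; exact: val_inj.
have rw' : reduced w by move: (rw); rewrite reduced_cons => /and3P[].
rewrite /= (IH rw') -psiE -psiM; congr psi; apply: val_inj => /=.
case: a rw => i g rw /=; rewrite -[RHS](lmul_reduced rw).
move: rw; rewrite reduced_cons => /and3P[/negbTE /= gN1 _ _].
by rewrite [X in wmul X _]/lmul /= gN1.
Qed.

End FreeProduct.

(* X ^ Gamma with the product topology; no topology on Gamma is involved. *)
Definition shift_space (Gamma : Type) (X : topologicalType) : topologicalType :=
  prod_topology (fun _ : Gamma => X).

Definition lshift_act (Gamma : groupType) (X : topologicalType) (g : Gamma)
    (x : shift_space Gamma X) : shift_space Gamma X :=
  fun d => x (g^-1 * d).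

Definition shift_orbit_rel (Gamma : groupType) (X : topologicalType)
    (x y : shift_space Gamma X) : Prop :=
  exists g : Gamma, lshift_act g x = y.

Definition borel (T : topologicalType) : set (set T) := <<s [set U | open U] >>.

Definition borel_fun (T U : topologicalType) (f : T -> U) : Prop :=
  forall B, borel B -> borel (f @^-1` B).

Definition borel_reduction (T U : topologicalType) (E : T -> T -> Prop)
    (F : U -> U -> Prop) (f : T -> U) : Prop :=
  borel_fun f /\ forall x y, E x y <-> F (f x) (f y).

(* The pieces may be empty. *)
Definition borel_partition (T : topologicalType) (J : Type) (A : J -> set T) :
    Prop :=
  [/\ forall j, borel (A j), trivIset setT A & \bigcup_j A j = setT].

(* Main.v *)
Require Import Defs.
From HB Require Import structures.
From mathcomp Require Import all_boot all_order all_algebra.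
From mathcomp Require Import all_classical all_reals all_analysis.
From mathcomp Require Import zify.

(* For each j, two players fill in a point y of (2^omega)^P, where P is the free
   product: the opponent owns the words starting with a letter of G j and a
   reserved infinite set of bits at the identity, the other player owns the rest
   and wants y to be in A j. By Borel determinacy each game has a winner. The
   opponent cannot win all the games, since his strategies could then be played
   against one another and would produce a point in no A j. A winning strategy
   of the other player in game j, played simultaneously from all elements of
   G j, yields for every filling of the reserved bits a point all of whose
   G j-translates are in A j; putting x in the reserved bits gives an injective
   equivariant continuous map.

   To obtain a reduction, the reserved bits receive the function
   g |-> kappa (g^-1 x) rather than x itself, for an injective kappa built after
   the strategy is known. A word w outside of G j sees the reserved bits of the
   translate by g only with a delay given by the length of g. Reserved bits come
   in stages so widely separated in time that only the finitely many g not
   longer than w have bits of the current stage visible from w, and these can be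
   kept equal to 0. Each stage has at least as many bits as there are possible
   values for the visible bits of the earlier stages, and its k-th bit is chosen
   to differ from the bit computed at w from the k-th such value. Hence the
   reserved bits at w never form a value kappa y unless y is a translate of x.

   Borel determinacy is proved by Martin's purely inductive argument: every
   Borel set becomes clopen in some covering game. *)

Set Implicit Arguments.
Unset Strict Implicit.
Unset Printing Implicit Defensive.

Local Open Scope classical_set_scope.

(** * Games and coverings *)

Definition pick_such T (d : T) (P : T -> Prop) : T :=
  if pselect (exists x, P x) is left e then sval (cid e) else d.

Lemma pick_suchP T (d : T) (P : T -> Prop) :
  (exists x, P x) -> P (pick_such d P).
Proof.
by move=> e; rewrite /pick_such; case: pselect => [e'|ne] //=; case: cid.
Qed.

Section Positions.
Context {X : Type}.
Implicit Types (a : nat -> X) (p q u : seq X).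

(* Positions are stored with the latest move first. *)
Fixpoint pre a n : seq X := if n is m.+1 then a m :: pre a m else [::].

(** Since the latest move comes first, dropping from the front keeps the [n] earliest moves. *)
Definition trunc n p := drop (size p - n) p.

Lemma size_pre a n : size (pre a n) = n.
Proof. by elim: n => //= n ->. Qed.

Lemma eq_pre a b n : (forall m, m < n -> a m = b m) -> pre a n = pre b n.
Proof.
elim: n => //= n IH h; rewrite h // IH // => m lm; apply: h; exact: ltnW.
Qed.

Lemma pre_inj a b n m : pre a n = pre b n -> m < n -> a m = b m.
Proof.
elim: n => //= n IH [h1 h2]; rewrite ltnS leq_eqVlt => /orP[/eqP->//|].
exact: IH.
Qed.

Lemma size_trunc n p : n <= size p -> size (trunc n p) = n.
Proof. by move=> h; rewrite /trunc size_drop; lia. Qed.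

Lemma trunc_cons n x p : n <= size p -> trunc n (x :: p) = trunc n p.
Proof. by move=> h; rewrite /trunc /= subSn. Qed.

Lemma trunc_ge n p : size p <= n -> trunc n p = p.
Proof. by rewrite -subn_eq0 /trunc => /eqP ->; rewrite drop0. Qed.

Lemma trunc_trunc m n p : trunc m (trunc n p) = trunc (minn m n) p.
Proof. by rewrite /trunc drop_drop size_drop; congr drop; lia. Qed.

Lemma trunc_pre a m n : m <= n -> trunc m (pre a n) = pre a m.
Proof.
elim: n => [|n IH]; first by case: m.
rewrite leq_eqVlt => /orP[/eqP ->|lmn]; first by rewrite trunc_ge ?size_pre.
by rewrite /= trunc_cons ?size_pre //; exact: IH.
Qed.

End Positions.

Lemma map_pre X Y (f : X -> Y) (a : nat -> X) n :
  map f (pre a n) = pre (f \o a) n.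
Proof. by elim: n => //= n ->. Qed.

Record game := Game {
  gmove :> Type;
  gtree : seq gmove -> Prop;
  gtree_nil : gtree [::];
  gtree_behead : forall x p, gtree (x :: p) -> gtree p;
  gtree_pruned : forall p, gtree p -> exists x, gtree (x :: p) }.

Section GameTheory.
Context (G : game).
Implicit Types (a : nat -> G) (p q : seq G) (s : seq G -> G) (b : bool).

Definition play a := forall n, gtree (pre a n).

(* Player [false] moves at even lengths, player [true] at odd lengths. *)
Definition legal b s :=
  forall p, gtree p -> odd (size p) = b -> gtree (s p :: p).

Definition follows b s a := forall n, odd n = b -> a n = s (pre a n).

Lemma gtree_trunc n p : gtree p -> gtree (trunc n p).
Proof.
elim: p => [|x p IH] // h; case: (leqP n (size p)) => [le|lt].
  rewrite trunc_cons //; apply: IH; exact: gtree_behead h.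
by rewrite trunc_ge.
Qed.

Definition gdflt : G := sval (cid (gtree_pruned (gtree_nil G))).

(** Turns any function on positions into a legal strategy without changing its legal moves. *)
Definition legalize p (x : G) : G :=
  if pselect (gtree (x :: p)) then x else
  if pselect (gtree p) is left h then sval (cid (gtree_pruned h)) else x.

Lemma legalizeP p x : gtree p -> gtree (legalize p x :: p).
Proof.
rewrite /legalize; case: pselect => [//|nx] gp; case: pselect => [h|//].
by case: cid.
Qed.

Lemma legalizeE p x : gtree (x :: p) -> legalize p x = x.
Proof. by rewrite /legalize; case: pselect. Qed.

Definition clopen_on (A : (nat -> G) -> Prop) := forall a, play a ->
  exists n, forall a', play a' -> pre a' n = pre a n -> (A a <-> A a').

End GameTheory.

(* Thanks to c_local, cphi makes sense for strategies known only up to some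
   length; this is what allows passing to limits. *)
Record covering N (H G : game) := Covering {
  cf : H -> G;
  cs : G -> H;
  cphi : bool -> (seq H -> H) -> (seq G -> G);
  c_csK : cancel cs cf;
  c_tree : forall p, gtree p -> gtree (map cf p);
  c_low : forall p, size p <= N -> gtree p -> gtree (map cs p);
  c_lowK : forall p, size p <= N -> gtree p -> map cs (map cf p) = p;
  c_legal : forall b s, legal b s -> legal b (cphi b s);
  c_local : forall b s t n, legal b s -> legal b t ->
    (forall q, gtree q -> size q <= n -> odd (size q) = b -> s q = t q) ->
    forall p, gtree p -> size p <= n -> odd (size p) = b ->
    cphi b s p = cphi b t p;
  c_copy : forall b s p, legal b s -> gtree p -> size p < N ->
    odd (size p) = b -> cphi b s p = cf (s (map cs p));
  c_lift : forall b s a, legal b s -> play a -> follows b (cphi b s) a ->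
    exists a', [/\ play a', follows b s a' & forall n, cf (a' n) = a n] }.

Section CoveringTheory.

Lemma play_cf N H G (c : covering N H G) (a : nat -> H) :
  play a -> play (cf c \o a).
Proof. by move=> pa n; rewrite -(map_pre _ a); exact: c_tree. Qed.

Definition covering_comp N K H G (d : covering N K H) (c : covering N H G) :
  covering N K G.
Proof.
exists (cf c \o cf d) (cs d \o cs c) (fun b s => cphi c b (cphi d b s)).
- by move=> x /=; rewrite !c_csK.
- by move=> p gp; rewrite map_comp; apply: c_tree; exact: c_tree.
- move=> p sp gp; rewrite map_comp; apply: c_low; first by rewrite size_map.
  exact: c_low.
- move=> p sp gp; rewrite (map_comp (cs d)) (map_comp (cf c)).
  rewrite c_lowK ?size_map //; last exact: c_tree.
  exact: c_lowK.
- by move=> b s ls; apply: c_legal; exact: c_legal.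
- move=> b s t n ls lt h.
  have ls' := c_legal d ls; have lt' := c_legal d lt.
  by apply: (@c_local _ _ _ c b _ _ n ls' lt'); exact: (@c_local _ _ _ d).
- move=> b s p ls gp sp op /=; rewrite c_copy //; last exact: c_legal.
  rewrite c_copy ?size_map //; first by rewrite -map_comp.
  by apply: c_low => //; exact: ltnW.
- move=> b s a ls pa fa; have [a1 [p1 f1 e1]] := c_lift (c_legal d ls) pa fa.
  have [a2 [p2 f2 e2]] := c_lift ls p1 f1.
  by exists a2; split => // n /=; rewrite e2.
Defined.

End CoveringTheory.

(** * Forcing an open set *)

Section Forcing.
Context {X : Type} (b : bool) (S U : seq X -> Prop).
Implicit Types (p q : seq X) (x : X) (a : nat -> X) (s t : seq X -> X).

Definition stays s := forall p, S p -> odd (size p) = b -> S (s p :: p).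

Definition wins_from s p := forall a, pre a (size p) = p ->
  (forall n, size p <= n -> S (pre a n)) ->
  (forall n, size p <= n -> odd n = b -> a n = s (pre a n)) ->
  exists2 n, size p <= n & U (pre a n).

(* Using strategies rather than ordinal ranks, membership in [forces] supplies
   a single strategy that need not be re-chosen along the play. *)
Definition forces p := exists2 s, stays s & wins_from s p.

Context (S_pruned : forall p, S p -> odd (size p) = b -> exists x, S (x :: p)).
Context (X0 : X).

Lemma stays_exists : exists s, stays s.
Proof.
have h p : exists x, S p -> odd (size p) = b -> S (x :: p).
  have [[Sp op]|nS] := pselect (S p /\ odd (size p) = b).
    by have [x hx] := S_pruned Sp op; exists x.
  by exists X0 => Sp op; case: nS.
have [s hs] := choice h; by exists s => p; exact: hs.
Qed.

Lemma forcing_strategies : exists t : seq X -> seq X -> X, forall p,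
  stays (t p) /\ (forces p -> wins_from (t p) p).
Proof.
have h p : exists s, stays s /\ (forces p -> wins_from s p).
  have [[s ss ws]|nf] := pselect (forces p); first by exists s.
  by have [s ss] := stays_exists; exists s; split.
by have [t ht] := choice h; exists t.
Qed.

Lemma forces_hit p : U p -> forces p.
Proof.
move=> Up; have [s ss] := stays_exists; exists s => // a ap _ _.
by exists (size p); rewrite ?ap.
Qed.

Lemma forces_mine p x : odd (size p) = b -> S (x :: p) ->
  forces (x :: p) -> forces p.
Proof.
move=> op Sx [s ss ws].
exists (fun q => if pselect (q = p) then x else s q).
  by by move=> q Sq oq; case: pselect => [e|ne] /=; [rewrite e|exact: ss].
move=> a ap Sa fa; have ax : a (size p) = x.
  by rewrite fa // ap; case: pselect => [e|ne] //=.
have [|n h|n h oq|n h Un] := ws a.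
- by rewrite /= ax ap.
- by apply: Sa; exact: ltnW.
- rewrite fa ?(ltnW h) //; case: pselect => [e|ne] //=.
  by move: h; rewrite /= -e size_pre ltnn.
- by exists n => //; exact: ltnW.
Qed.

Lemma forces_other p : odd (size p) = ~~ b ->
  (forall x, S (x :: p) -> forces (x :: p)) -> forces p.
Proof.
move=> op h; have [t ht] := forcing_strategies.
(* [trunc (size p).+1 q] shows the opponent's reply at [p], and [t] supplies one fixed winning
   strategy for each reply. *)
exists (fun q => t (trunc (size p).+1 q) q).
  by move=> q Sq oq; exact: (ht _).1.
move=> a ap Sa fa; pose q := pre a (size p).+1.
have eq : q = a (size p) :: p by rewrite /q /= ap.
have fq : forces q by rewrite eq; apply: h; rewrite -eq; exact: Sa.
have sq : size q = (size p).+1 by rewrite size_pre.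
have [||n hn on|n hn Un] := (ht q).2 fq a; rewrite ?sq //.
- by move=> n hn; apply: Sa; exact: ltnW.
- by rewrite sq in hn; rewrite fa ?(ltnW hn) // trunc_pre.
- by exists n => //; rewrite sq in hn; exact: ltnW.
Qed.

(** The positions kept by the standard defence against [forces], as in the Gale-Stewart theorem. *)
Definition avoids q p := [/\ S p, size q <= size p, trunc (size q) p = q &
  forall m, size q <= m <= size p -> ~ forces (trunc m p)].

End Forcing.

(** * Gluing strategies along the phases of an attack *)

Section Combine.
Context {G : game} (b : bool) (S U : seq G -> Prop) (n0 : nat).
Context (g : seq G -> seq G -> G) (h : seq G -> G).
Implicit Types (p q : seq G) (a : nat -> G).

Definition first_in (V : seq G -> Prop) p m :=
  [/\ n0 <= m <= size p, V (trunc m p) &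
      forall j, n0 <= j < m -> ~ V (trunc j p)].

Definition forcing_choice : seq G -> seq G -> G :=
  pick_such (fun _ _ => gdflt G) (fun t => forall p,
    stays b S (t p) /\ (forces b S U p -> wins_from b S U (t p) p)).

(** Three phases, all read off from [p]: [h] until [U] can be forced, then the winning strategy
    fixed at the first forcing position, then [g] with the first position in [U] as parameter. *)
Definition combine p : G :=
  if pselect (exists m, first_in U p m) is left e
  then g (trunc (sval (cid e)) p) p else
  if pselect (exists m, first_in (forces b S U) p m) is left e
  then forcing_choice (trunc (sval (cid e)) p) p else h p.

Lemma first_in_exists V p m : n0 <= m <= size p -> V (trunc m p) ->
  exists m, first_in V p m.
Proof.
move=> hm Vm; pose P m := `[< n0 <= m <= size p /\ V (trunc m p) >].
have exP : exists m, P m by exists m; apply/asboolP.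
case: (ex_minnP exP) => k /asboolP[hk Vk] mk; exists k; split => // j hj Vj.
have : P j by apply/asboolP; split => //; lia.
by move/mk; lia.
Qed.

Lemma first_in_uniq V p m m' : first_in V p m -> first_in V p m' -> m = m'.
Proof.
move=> [h1 V1 l1] [h2 V2 l2]; case: (ltngtP m m') => // lt.
  by case: (l2 m) => //; lia.
by case: (l1 m') => //; lia.
Qed.

Context (S_pruned : forall p, S p -> odd (size p) = b -> exists x, S (x :: p)).
Context (S_tree : forall p, S p -> gtree p).
Context (S_closed : forall p x, S p -> odd (size p) = ~~ b ->
  gtree (x :: p) -> S (x :: p)).

Lemma forcing_choiceP p : stays b S (forcing_choice p) /\
  (forces b S U p -> wins_from b S U (forcing_choice p) p).
Proof.
exact: pick_suchP (forcing_strategies U S_pruned (gdflt G)) p.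
Qed.

(** The middle phase cannot last, because the strategy fixed there reaches [U]. So a play either
    enters the [g] phase or stays in the [h] phase forever. *)
Lemma combine_play a : play a -> S (pre a n0) ->
  (forall n, n0 <= n -> odd n = b -> S (pre a n) ->
    (forall m, n0 <= m <= n -> ~ forces b S U (pre a m)) ->
    S (h (pre a n) :: pre a n)) ->
  (forall n, n0 <= n -> odd n = b ->
    a n = legalize (pre a n) (combine (pre a n))) ->
  (exists m, [/\ n0 <= m, U (pre a m), S (pre a m) &
     forall n, m <= n -> odd n = b ->
       a n = legalize (pre a n) (g (pre a m) (pre a n))]) \/
  (forall n, n0 <= n -> [/\ S (pre a n), ~ forces b S U (pre a n) &
     odd n = b -> a n = h (pre a n)]).
Proof.
move=> pa S0 Sh fa.
have hit n m : n0 <= m <= n -> U (pre a m) ->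
    (forall j, n0 <= j < m -> ~ U (pre a j)) ->
    combine (pre a n) = g (pre a m) (pre a n).
  move=> hm Um lm.
  have fm : first_in U (pre a n) m.
    split; rewrite ?size_pre ?trunc_pre //; first by lia.
    by move=> j hj; rewrite trunc_pre; [exact: lm|lia].
  rewrite /combine; case: pselect => [e|]; last by case; exists m.
  case: cid => k hk /=; rewrite (first_in_uniq hk fm) trunc_pre //; lia.
have nhit n : (forall m, n0 <= m <= n -> ~ U (pre a m)) ->
    ~ exists m, first_in U (pre a n) m.
  move=> nU [m []]; rewrite size_pre => hm.
  by rewrite trunc_pre; [move=> Um; case: (nU m hm)|lia].
have win n m : n0 <= m <= n -> (forall j, n0 <= j <= n -> ~ U (pre a j)) ->
    forces b S U (pre a m) ->
    (forall j, n0 <= j < m -> ~ forces b S U (pre a j)) ->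
    combine (pre a n) = forcing_choice (pre a m) (pre a n).
  move=> hm nU Fm lm.
  have fm : first_in (forces b S U) (pre a n) m.
    split; rewrite ?size_pre ?trunc_pre //; first by lia.
    by move=> j hj; rewrite trunc_pre; [exact: lm|lia].
  rewrite /combine; case: pselect => [e|_]; first by case: (nhit n nU).
  case: pselect => [e|]; last by case; exists m.
  case: cid => k hk /=; rewrite (first_in_uniq hk fm) trunc_pre //; lia.
have nwin n : (forall j, n0 <= j <= n -> ~ U (pre a j)) ->
    (forall m, n0 <= m <= n -> ~ forces b S U (pre a m)) ->
    combine (pre a n) = h (pre a n).
  move=> nU nF; rewrite /combine; case: pselect => [e|_].
    by case: (nhit n nU).
  case: pselect => [e|//]; exfalso; case: e => m []; rewrite size_pre => hm.
  by rewrite trunc_pre; [move=> Um; case: (nF m hm)|lia].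
have least (V : seq G -> Prop) m : n0 <= m -> V (pre a m) ->
    exists k, [/\ n0 <= k <= m, V (pre a k) &
      forall j, n0 <= j < k -> ~ V (pre a j)].
  move=> hm Vm; have [||k []] := @first_in_exists V (pre a m) m.
  - by rewrite size_pre hm /=.
  - by rewrite trunc_pre.
  rewrite size_pre => hk; rewrite trunc_pre; last by lia.
  move=> Vk lk; exists k; split => // j hj.
  by have := lk j hj; rewrite trunc_pre //; lia.
(* Before [U] is hit every phase keeps the play in [S], so [legalize] alters no move of
   [combine]. *)
have Sn n : n0 <= n -> (forall j, n0 <= j < n -> ~ U (pre a j)) -> S (pre a n).
  elim: n => [|n IH] hn nU; first by move: S0; have -> : n0 = 0 by lia.
  move: hn; rewrite leq_eqVlt => /orP[/eqP <-//|]; rewrite ltnS => hn.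
  have Sp : S (pre a n) by apply: IH => // j hj; apply: nU; lia.
  have nU' j : n0 <= j <= n -> ~ U (pre a j) by move=> hj; apply: nU; lia.
  case: (eqVneq (odd n) b) => [on|/eqP on]; last first.
    apply: S_closed => //; last exact: (pa n.+1).
    by rewrite size_pre; case: (odd n) b on => [] [].
  rewrite /= fa //.
  have [[m [hm Fm]]|nF] :=
      pselect (exists m, n0 <= m <= n /\ forces b S U (pre a m)).
    have [|k [hk Fk lk]] := least (forces b S U) m _ Fm; first by lia.
    rewrite (@win n k) //; last by lia.
    have Sx : S (forcing_choice (pre a k) (pre a n) :: pre a n).
      by apply: (forcing_choiceP _).1 => //; rewrite size_pre.
    by rewrite legalizeE //; exact: S_tree.
  have nF' m : n0 <= m <= n -> ~ forces b S U (pre a m).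
    by move=> hm Fm; apply: nF; exists m.
  rewrite nwin //; have Sx := Sh n hn on Sp nF'.
  by rewrite legalizeE //; exact: S_tree.
have [[m [hm Um]]|nU] := pselect (exists m, n0 <= m /\ U (pre a m)).
  have [k [hk Uk lk]] := least U m hm Um; left; exists k; split => //.
  - by lia.
  - by apply: Sn => //; lia.
  - by move=> n hn on; rewrite fa //; [rewrite (@hit n k) //; lia|lia].
have nU' j : n0 <= j -> ~ U (pre a j) by move=> hj Uj; apply: nU; exists j.
right.
have nF m : n0 <= m -> ~ forces b S U (pre a m).
  move=> hm Fm; have [k [hk Fk lk]] := least (forces b S U) m hm Fm.
  have [||n hn on|n hn] := (forcing_choiceP (pre a k)).2 Fk a;
    rewrite ?size_pre //.
  - by move=> n hn; apply: Sn => [|j hj]; [lia|apply: nU'; lia].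
  - rewrite size_pre in hn; rewrite {1}fa //; last by lia.
    rewrite (@win n k) //; [|lia|by move=> j hj; apply: nU'; lia].
    rewrite legalizeE //; apply: S_tree; apply: (forcing_choiceP _).1.
      by apply: Sn => [|j hj]; [lia|apply: nU'; lia].
    by rewrite size_pre.
  - by rewrite size_pre in hn; apply: nU'; lia.
move=> n hn; have Sp : S (pre a n).
  by apply: Sn => // j hj; apply: nU'; lia.
split=> //; first exact: nF.
move=> on; have nFn m : n0 <= m <= n -> ~ forces b S U (pre a m).
  by move=> hm; apply: nF; lia.
rewrite {1}fa // nwin //; last by move=> j hj; apply: nU'; lia.
by rewrite legalizeE //; apply: S_tree; exact: Sh.
Qed.

End Combine.

(** * Unravelling open sets *)

Section Unravel.
Context (G : game) (N : nat) (D : seq G -> Prop).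
Context (D_up : forall x p, gtree (x :: p) -> D p -> D (x :: p)).
Implicit Types (p q u : seq G) (x : G) (a : nat -> G) (S T : seq G -> Prop).
(** An even length not below [N]: player false moves at [K], player true at [K.+1], and the moves
    before length [N] carry no mark. *)
Local Notation K := N.*2.

(* T is a quasi-strategy in S from position q: it restricts the moves of
   player b only. *)
Record quasi (b : bool) S q T : Prop := MkQuasi {
  quasi_sub : forall p, T p -> S p;
  quasi_base : T q;
  quasi_ext : forall p, T p -> size q <= size p /\ trunc (size q) p = q;
  quasi_behead : forall x p, T (x :: p) -> size q <= size p -> T p;
  quasi_other : forall p x, T p -> odd (size p) = ~~ b -> S (x :: p) ->
    T (x :: p);
  quasi_mine : forall p, T p -> odd (size p) = b -> exists x, T (x :: p) }.

(** From a position that is not forcing, player [b] has no move to a forcing one by [forces_mine],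
    and his opponent always has a move to one that is not by [forces_other]. *)
Lemma avoids_quasi b S U q :
  (forall p, S p -> exists x, S (x :: p)) ->
  (forall x p, S (x :: p) -> size q <= size p -> S p) ->
  S q -> ~ forces b S U q -> quasi (~~ b) S q (avoids b S U q).
Proof.
move=> Sp Sb Sq nq; have Sp' p : S p -> odd (size p) = b ->
  exists x, S (x :: p) by move=> + _; exact: Sp.
have ext x p : avoids b S U q p -> S (x :: p) -> ~ forces b S U (x :: p) ->
    avoids b S U q (x :: p).
  move=> [h1 h2 h3 h4] Sx nx; split => //=; first exact: leqW.
    by rewrite trunc_cons.
  move=> m; case: (eqVneq m (size p).+1) => [->|hm] hm'.
    by rewrite trunc_ge.
  by rewrite trunc_cons; [apply: h4; lia|lia].
have nf p : avoids b S U q p -> ~ forces b S U p.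
  move=> [h1 h2 h3 /(_ (size p))]; rewrite trunc_ge //; apply; lia.
split.
- by move=> p [].
- split=> //; first by rewrite trunc_ge.
  by move=> m hm; rewrite trunc_ge //; lia.
- by move=> p [].
- move=> x p [h1 h2 h3 h4] sp; split=> //; first exact: Sb h1 sp.
    by move: h3; rewrite trunc_cons.
  by move=> m hm; have := h4 m; rewrite trunc_cons /=; [apply; lia|lia].
- move=> p x ap op Sx; apply: ext => // fx; apply: (nf _ ap).
  by rewrite negbK in op; exact: forces_mine op Sx fx.
- move=> p ap op; apply: contrapT => nx; apply: (nf _ ap).
  apply: (forces_other Sp' (gdflt G) op) => x Sx.
  by apply: contrapT => fx; apply: nx; exists x; exact: ext.
Qed.

(* In the covering game, player false must announce a quasi-strategy S together
   with his move at length K; player true answers either by a position of D that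
   S allows, which the rest of the play has to follow, or by a quasi-strategy in
   S avoiding D. This answer decides whether D will be reached. *)
Inductive mark := Plain | Quasi of seq G -> Prop | Exit of seq G.

Implicit Types (t : mark).

(** The positions of the covering game are those of [G] with two marks, on the moves made at lengths
    [K] and [K.+1]. *)
Fixpoint deco t0 t1 p : seq (G * mark) := if p is x :: p' then
  (x, if size p' == K then t0 else if size p' == K.+1 then t1 else Plain)
    :: deco t0 t1 p' else [::].

Lemma deco_fst t0 t1 p : map fst (deco t0 t1 p) = p.
Proof. by elim: p => //= x p ->. Qed.

Lemma size_deco t0 t1 p : size (deco t0 t1 p) = size p.
Proof. by elim: p => //= x p ->. Qed.

Lemma deco_irr0 t0 t1 t0' t1' p : size p <= K ->
  deco t0 t1 p = deco t0' t1' p.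
Proof.
elim: p => //= x p IH hp; rewrite (IH (ltnW hp)); do ![case: eqP => //]; lia.
Qed.

Lemma deco_irr1 t0 t1 t1' p : size p <= K.+1 -> deco t0 t1 p = deco t0 t1' p.
Proof.
elim: p => //= x p IH hp; rewrite (IH (ltnW hp)); do ![case: eqP => //]; lia.
Qed.

Lemma deco_inj0 t0 t1 t0' t1' p : K < size p ->
  deco t0 t1 p = deco t0' t1' p -> t0 = t0'.
Proof.
elim: p => //= x p IH hp [e1 e2].
case: (eqVneq (size p) K) e1 => [//|h _]; apply: IH e2; lia.
Qed.

Lemma deco_inj1 t0 t1 t0' t1' p : K.+1 < size p ->
  deco t0 t1 p = deco t0' t1' p -> t1 = t1'.
Proof.
elim: p => //= x p IH hp [e1 e2].
case: (eqVneq (size p) K) e1 => [h|h]; first by lia.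
case: (eqVneq (size p) K.+1) => [//|h' _]; apply: IH e2; lia.
Qed.

(** One of [u] and [p] is an initial segment of the other. *)
Definition compat u p := trunc (size p) u = trunc (size u) p.

Lemma compat_behead u x p : compat u (x :: p) -> compat u p.
Proof.
rewrite /compat /= => /(congr1 (trunc (size p))).
rewrite !trunc_trunc (minn_idPl (leqnSn _)) => ->.
rewrite trunc_cons ?geq_minl //.
case: (leqP (size p) (size u)) => h.
  by rewrite !trunc_ge.
by [].
Qed.

Lemma compat_pre a m n : compat (pre a m) (pre a n).
Proof.
rewrite /compat !size_pre; case: (leqP m n) => h.
  by rewrite trunc_ge ?size_pre // trunc_pre.
by rewrite trunc_pre ?[RHS]trunc_ge ?size_pre // ltnW.
Qed.

Definition option_ok S t1 p :=
  (exists T, [/\ t1 = Quasi T, quasi true S (trunc K.+2 p) T,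
     forall q, T q -> ~ D q & T p]) \/
  (exists u, [/\ t1 = Exit u, S u, D u, K.+2 <= size u & compat u p]).

Definition tags_ok t0 t1 p := K < size p -> exists S,
  [/\ t0 = Quasi S, quasi false (@gtree G) (trunc K.+1 p) S &
      K.+1 < size p -> option_ok S t1 p].

Definition utree (r : seq (G * mark)) := gtree (map fst r) /\
  exists t0 t1, r = deco t0 t1 (map fst r) /\ tags_ok t0 t1 (map fst r).

Lemma utree_decoP t0 t1 p :
  utree (deco t0 t1 p) <-> gtree p /\ tags_ok t0 t1 p.
Proof.
rewrite /utree deco_fst; split=> [[gp [t0' [t1' [e h]]]]|[gp h]]; last first.
  by split=> //; exists t0, t1.
split=> // sp; have [S [h1 h2 h3]] := h sp.
have e0 := deco_inj0 sp e; exists S; split=> // [|sp']; first by rewrite e0.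
by rewrite (deco_inj1 sp' e); exact: h3.
Qed.

Lemma utree_small t0 t1 p : size p <= K -> gtree p -> utree (deco t0 t1 p).
Proof. by move=> sp gp; apply/utree_decoP; split => // sp'; exfalso; lia. Qed.

Lemma option_ok_behead S t1 x p : K.+1 < size p ->
  option_ok S t1 (x :: p) -> option_ok S t1 p.
Proof.
move=> sp [[T [h1 h2 h3 h4]]|[u [h1 h2 h3 h4 h5]]].
  rewrite trunc_cons // in h2.
  left; exists T; split => //; apply: (quasi_behead h2 h4).
  by rewrite size_trunc.
by right; exists u; split => //; exact: compat_behead h5.
Qed.

Lemma tags_ok_behead t0 t1 x p : tags_ok t0 t1 (x :: p) -> tags_ok t0 t1 p.
Proof.
move=> h sp; have [|S [h1 h2 h3]] := h; first by rewrite /= ltnW.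
rewrite trunc_cons // in h2; exists S; split=> // sp'.
by apply: option_ok_behead (h3 _) => //=; lia.
Qed.

Lemma utree_nil : utree [::].
Proof. exact: (@utree_small Plain Plain [::] isT (gtree_nil G)). Qed.

Lemma utree_behead z r : utree (z :: r) -> utree r.
Proof.
move=> [gp [t0 [t1 [[_ e] h]]]]; split; first exact: gtree_behead gp.
by exists t0, t1; split => //; exact: tags_ok_behead h.
Qed.

Lemma utree_pruned r : utree r -> exists z, utree (z :: r).
Proof.
move=> [gp [t0 [t1 [e h]]]]; move: (map fst r) gp e h => p gp -> h {r}.
have [x gx] := gtree_pruned gp.
have main y t0' t1' : gtree (y :: p) -> deco t0 t1 p = deco t0' t1' p ->
    tags_ok t0' t1' (y :: p) -> exists z, utree (z :: deco t0 t1 p).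
  move=> gy e hy; rewrite e; set z := head (y, Plain) (deco t0' t1' (y :: p)).
  by exists z; apply/(utree_decoP t0' t1' (y :: p)).
case: (ltngtP (size p) K) => sp.
- by apply: (main x t0 t1) => // /= sp'; exfalso; rewrite /= in sp'; lia.
- have [S [h1 h2 h3]] := h sp.
  case: (ltngtP (size p) K.+1) => [|sp'|sp']; first by lia.
    have main' y : gtree (y :: p) -> option_ok S t1 (y :: p) ->
        exists z, utree (z :: deco t0 t1 p).
      move=> gy oy; apply: (main y t0 t1) => // _; exists S.
      by split => //; rewrite trunc_cons.
    case: (h3 sp') => [[T [e1 e2 e3 e4]]|[u [e1 e2 e3 e4 e5]]].
      have [y Ty] : exists y, T (y :: p).
        case: (boolP (odd (size p))) => op; first exact: (quasi_mine e2).
        have Sp := quasi_sub e2 e4.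
        have [|y Sy] := quasi_mine h2 Sp; first exact/negbTE.
        by exists y; apply: (quasi_other e2) => //; exact/negbTE.
      apply: (main' y); first exact/(quasi_sub h2)/(quasi_sub e2).
      by left; exists T; split=> //; rewrite trunc_cons.
    (* Once the exit [u] is passed any legal move will do; before that the next move of [u] is
       played. *)
    case: (leqP (size u) (size p)) => su.
      apply: (main' x) => //; right; exists u; split=> //.
      move: e5; rewrite /compat /= trunc_cons // !(@trunc_ge _ _ u) //.
      exact: leqW.
    have st : size (trunc (size p).+1 u) = (size p).+1 by rewrite size_trunc.
    case E : (trunc (size p).+1 u) st => [//|y p'] /= [sp''].
    have ep : p' = p.
      have /(congr1 (trunc (size p))) := E; rewrite trunc_trunc.
      rewrite (minn_idPl (leqnSn _)) trunc_cons ?sp'' //.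
      rewrite (@trunc_ge _ _ p') ?sp'' // => <-.
      by rewrite e5 trunc_ge // ltnW.
    subst p'; apply: (main' y).
      by rewrite -E; apply: gtree_trunc; exact: (quasi_sub h2).
    by right; exists u; split=> //; rewrite /compat /= E trunc_ge.
  have tp : trunc K.+1 p = p by rewrite trunc_ge ?sp'.
  have Sp : S p by rewrite -tp; exact: (quasi_base h2).
  have Sx : S (x :: p).
    by apply: (quasi_other h2) => //; rewrite sp' /= odd_double.
  have tx : trunc K.+2 (x :: p) = x :: p by rewrite trunc_ge //= sp'.
  have deq t : deco t0 t1 p = deco t0 t p by apply: deco_irr1; rewrite sp'.
  have tags t : option_ok S t (x :: p) -> tags_ok t0 t (x :: p).
    by move=> o _; exists S; split => //; rewrite trunc_cons // sp'.
  have [[u [Su Du su cu]]|nu] := pselect (exists u,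
      [/\ S u, D u, K.+2 <= size u & compat u (x :: p)]).
    by apply: (main x t0 (Exit u)) => //; apply: tags; right; exists u.
  (* No position of [D] in [S] extends [x :: p], so all of [S] above [x :: p] avoids [D]. *)
  pose T q := [/\ S q, (size p).+1 <= size q & trunc (size p).+1 q = x :: p].
  apply: (main x t0 (Quasi T)) => //; apply: tags; left; exists T; split=> //.
  + rewrite tx; split=> /=.
    * by move=> q [].
    * by split=> //; rewrite trunc_ge.
    * by move=> q [].
    * move=> y q [k1 k2 k3] sq; split => //.
        by apply: (quasi_behead h2 k1); rewrite tp; lia.
      by move: k3; rewrite trunc_cons.
    * move=> q y [k1 k2 k3] oq Sy; split => //=; first by lia.
      by rewrite trunc_cons.
    * move=> q [k1 k2 k3] oq.
      have [y gy] := gtree_pruned (quasi_sub h2 k1).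
      exists y; split => //=; [exact: (quasi_other h2)|by lia|].
      by rewrite trunc_cons.
  + move=> q [k1 k2 k3] Dq; apply: nu; exists q; split=> //.
      by rewrite -sp'.
    by rewrite /compat /= k3 trunc_ge.
  + by split=> //; rewrite trunc_ge.
(* The whole tree above [x :: p] can always be announced. *)
- pose S q := [/\ gtree q, K.+1 <= size q & trunc K.+1 q = x :: p].
  have tx : trunc K.+1 (x :: p) = x :: p by rewrite trunc_ge //= sp.
  apply: (main x (Quasi S) t1) => //.
    by apply: deco_irr0; rewrite sp.
  move=> _; exists S; split=> //=; last by lia.
  rewrite tx; split=> //=; rewrite ?sp.
  + by move=> q [].
  + by split=> //=; rewrite sp.
  + by move=> q [].
  + move=> y q [k1 k2 k3] sq; split => //; first exact: gtree_behead k1.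
    by move: k3; rewrite trunc_cons.
  + move=> q y [k1 k2 k3] oq gy; split=> //=; first by lia.
    by rewrite trunc_cons.
  + move=> q [k1 k2 k3] oq; have [y gy] := gtree_pruned k1.
    by exists y; split=> //=; [lia|rewrite trunc_cons].
Qed.

Definition ugame : game :=
  @Game (G * mark)%type utree utree_nil utree_behead utree_pruned.

Lemma utree_stepE z t0 t1 p : utree (z :: deco t0 t1 p) ->
  gtree (z.1 :: p) /\ exists t0' t1',
    [/\ deco t0 t1 p = deco t0' t1' p,
        z.2 = (if size p == K then t0' else if size p == K.+1 then t1'
               else Plain) & tags_ok t0' t1' (z.1 :: p)].
Proof.
move=> [gp [t0' [t1' []]]]; rewrite /= in gp *; rewrite !deco_fst in gp *.
move=> -[e1 e2] h; split=> //; exists t0', t1'; split => //.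
by rewrite e1.
Qed.

Lemma utree_early z t0 t1 p : size p < K -> utree (z :: deco t0 t1 p) ->
  z.2 = Plain.
Proof.
move=> sp /utree_stepE[_ [t0' [t1' [_ -> _]]]].
by do ![case: eqP => //]; lia.
Qed.

Lemma utree_at0 z t0 t1 p : size p = K -> utree (z :: deco t0 t1 p) ->
  exists S, z.2 = Quasi S /\ quasi false (@gtree G) (z.1 :: p) S.
Proof.
move=> sp /utree_stepE[_ [t0' [t1' [_ e h]]]].
have [|S [h1 h2 _]] := h; first by rewrite /= sp.
exists S; rewrite e sp eqxx h1; split => //.
by move: h2; rewrite trunc_ge //= sp.
Qed.

Lemma utree_at1 z t0 t1 p : size p = K.+1 -> utree (z :: deco t0 t1 p) ->
  exists S, t0 = Quasi S /\ option_ok S z.2 (z.1 :: p).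
Proof.
move=> sp /utree_stepE[_ [t0' [t1' [e1 e h]]]].
have [|S [h1 h2 h3]] := h; first by rewrite /= sp.
exists S; rewrite -h1; split; first by apply: deco_inj0 e1; rewrite sp.
move: e; rewrite sp eqxx; case: eqP => [|_ ->]; first by lia.
by apply: h3; rewrite /= sp.
Qed.

Lemma utree_late z t0 t1 p : K.+1 < size p -> utree (z :: deco t0 t1 p) ->
  z.2 = Plain /\ exists S, t0 = Quasi S /\ option_ok S t1 (z.1 :: p).
Proof.
move=> sp /utree_stepE[_ [t0' [t1' [e1 -> h]]]].
split; first by do ![case: eqP => //]; lia.
have [|S [h1 h2 h3]] := h; first by rewrite /=; lia.
exists S; rewrite -h1; split; first by apply: deco_inj0 e1; lia.
by rewrite (deco_inj1 sp e1); apply: h3; rewrite /=; lia.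
Qed.

(** * Transfer of strategies to the base game *)

Local Notation strat := (seq (G * mark) -> G * mark).
Implicit Types (r s : strat).

(** Values off the tree, and for [cut] also at positions longer than [K.+1], become a default, so
    that agreement of two strategies on short legal positions yields plain equalities in
    [uphi_local]. *)
Definition fixs s : strat :=
  fun w => if pselect (utree w) then s w else (gdflt G, Plain).

Definition cut s : strat :=
  fun w => if pselect (utree w /\ size w <= K.+1) then s w
           else (gdflt G, Plain).

Lemma fixsE s w : utree w -> fixs s w = s w.
Proof. by rewrite /fixs; case: pselect. Qed.

Lemma cutE s w : utree w -> size w <= K.+1 -> cut s w = s w.
Proof. by move=> h1 h2; rewrite /cut; case: pselect => // -[]. Qed.

(* Player false: the opponent is imagined to announce the set of positions from
   which D cannot be forced; once a position u in D is reached, he is imagined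
   to have announced u instead. *)
Definition quasi_of r p : seq G -> Prop :=
  if (r (deco Plain Plain p)).2 is Quasi T then T else fun _ => False.

Definition phi0 r s p : G :=
  let S := quasi_of r (trunc K p) in
  let T := avoids false S D (trunc K.+2 p) in
  combine false S D K.+2 (fun u p => (s (deco (Quasi S) (Exit u) p)).1)
    (fun p => (s (deco (Quasi S) (Quasi T) p)).1) p.

(* Player true: the opponent is imagined to announce the set of positions from
   which no exit granted by the strategy can be forced; once such an exit is
   reached, he is imagined to have announced a quasi-strategy granting it. *)
Definition grants r q u S := quasi false (@gtree G) q S /\
  (r (deco (Quasi S) Plain q)).2 = Exit u.

Definition exits r q u := exists S, grants r q u S.

Definition exit_quasi r q u : seq G -> Prop :=
  pick_such (fun _ => False) (grants r q u).

Definition no_exit r q := avoids true (@gtree G) (exits r q) q.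

Definition phi1 r s p : G :=
  let q := trunc K.+1 p in
  combine true (@gtree G) (exits r q) K.+1
    (fun u p => (s (deco (Quasi (exit_quasi r q u)) (Exit u) p)).1)
    (fun p => legalize p (s (deco (Quasi (no_exit r q))
       (r (deco (Quasi (no_exit r q)) Plain q)).2 p)).1) p.

(** At positions of length up to [K], inclusive, no mark has been made yet and the strategy is
    copied. *)
Definition uphi (b : bool) s p : G := legalize p
  (if size p <= K then (fixs s (deco Plain Plain p)).1
   else (if b then phi1 else phi0) (cut s) (fixs s) p).

Lemma uphi_legal b s : @legal ugame b s -> legal b (uphi b s).
Proof. by move=> ls p gp op; exact: legalizeP. Qed.

Lemma combine_ext b S U n0 (g g' : seq G -> seq G -> G) (h h' : seq G -> G) p :
  (forall u, g u p = g' u p) -> h p = h' p ->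
  combine b S U n0 g h p = combine b S U n0 g' h' p.
Proof. by move=> eg eh; rewrite /combine; do ![case: pselect => ? //=]. Qed.

Lemma uphi_local b s s' n :
  (forall w, utree w -> size w <= n -> odd (size w) = b -> s w = s' w) ->
  forall p, gtree p -> size p <= n -> odd (size p) = b ->
  uphi b s p = uphi b s' p.
Proof.
move=> h p gp sp op; rewrite /uphi; congr legalize.
have ef t0 t1 : fixs s (deco t0 t1 p) = fixs s' (deco t0 t1 p).
  by rewrite /fixs; case: pselect => [up|nup] //=; rewrite h ?size_deco.
case: leqP => spK; first by rewrite ef.
rewrite /phi0 /phi1; case: b h op => h op.
  have e q : size q = K.+1 -> forall S,
      cut s (deco (Quasi S) Plain q) = cut s' (deco (Quasi S) Plain q).
    move=> sq S; rewrite /cut; case: pselect => [u|nu] //=; case: u => uq _.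
    by rewrite h // size_deco sq; [exact: leq_trans sp|rewrite /= odd_double].
  have sq : size (trunc K.+1 p) = K.+1 by rewrite size_trunc.
  have eG : grants (cut s) (trunc K.+1 p) = grants (cut s') (trunc K.+1 p).
    by apply/funext => u; apply/funext => S; rewrite /grants e.
  have eE : exits (cut s) (trunc K.+1 p) = exits (cut s') (trunc K.+1 p).
    by apply/funext => u; rewrite /exits eG.
  have eQ u : exit_quasi (cut s) (trunc K.+1 p) u =
              exit_quasi (cut s') (trunc K.+1 p) u.
    by rewrite /exit_quasi eG.
  have eN : no_exit (cut s) (trunc K.+1 p) = no_exit (cut s') (trunc K.+1 p).
    by rewrite /no_exit eE.
  rewrite eE; apply: combine_ext => [u|]; first by rewrite eQ ef.
  by rewrite eN ef e.
have -> : quasi_of (cut s) (trunc K p) = quasi_of (cut s') (trunc K p).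
  rewrite /quasi_of /cut; case: pselect => [u|nu] //=; case: u => uq sq.
  have st : size (trunc K p) = K by rewrite size_trunc // ltnW.
  by rewrite h // size_deco st ?odd_double //; exact: leq_trans (ltnW spK) sp.
by apply: combine_ext => [u|]; rewrite ef.
Qed.

Lemma legal_step b s t0 t1 p : @legal ugame b s -> utree (deco t0 t1 p) ->
  odd (size p) = b -> utree (s (deco t0 t1 p) :: deco t0 t1 p).
Proof. by move=> ls up op; apply: ls; rewrite // size_deco. Qed.

Lemma uphi_copy b s p : @legal ugame b s -> gtree p -> size p <= K ->
  odd (size p) = b -> uphi b s p = (s (deco Plain Plain p)).1.
Proof.
move=> ls gp sp op; rewrite /uphi sp.
have up : utree (deco Plain Plain p) by exact: utree_small.
rewrite fixsE //; apply: legalizeE.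
by have [] := utree_stepE (legal_step ls up op).
Qed.

Definition relift t0 t1 a n : G * mark :=
  (a n, if n == K then t0 else if n == K.+1 then t1 else Plain).

Lemma pre_relift t0 t1 a n : pre (relift t0 t1 a) n = deco t0 t1 (pre a n).
Proof. by elim: n => //= n ->; rewrite size_pre. Qed.

Lemma play_relift S t1 a : play a ->
  quasi false (@gtree G) (pre a K.+1) S ->
  (forall n, K.+2 <= n -> option_ok S t1 (pre a n)) ->
  @play ugame (relift (Quasi S) t1 a).
Proof.
move=> pa qS h n; rewrite pre_relift; apply/utree_decoP; split; first exact: pa.
rewrite /tags_ok size_pre => hn; exists S; split=> //.
  by rewrite trunc_pre.
by move=> hn'; exact: h.
Qed.

Lemma follow_early b s S t1 a : @legal ugame b s -> play a ->
  follows b (uphi b s) a -> forall n, n < K -> odd n = b ->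
  relift (Quasi S) t1 a n = s (pre (relift (Quasi S) t1 a) n).
Proof.
move=> ls pa fa n hn on; rewrite pre_relift /relift.
have gn : gtree (pre a n) by exact: pa.
have sn : size (pre a n) <= K by rewrite size_pre ltnW.
have up : utree (deco Plain Plain (pre a n)) by exact: utree_small.
rewrite fa // uphi_copy ?size_pre ?(ltnW hn) //.
rewrite (@deco_irr0 _ _ Plain Plain) //.
have := utree_early _ (legal_step ls up _); rewrite size_pre => /(_ hn on).
case: (s _) => x t /= ->; congr pair.
by do ![case: eqP => //]; lia.
Qed.

(* While u is not yet reached, legality alone forces the moves along u. *)
Lemma follow_exit b s S a m : @legal ugame b s ->
  let u := pre a m in let c := relift (Quasi S) (Exit u) a in
  @play ugame c -> forall n, K.+2 <= n -> odd n = b ->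
  (m <= n -> a n = legalize (pre a n) (fixs s (deco (Quasi S) (Exit u)
                                          (pre a n))).1) ->
  c n = s (pre c n).
Proof.
move=> ls u c pc n hn on h.
have un : utree (deco (Quasi S) (Exit u) (pre a n)).
  by rewrite -pre_relift; exact: (pc n).
have := legal_step ls un; rewrite size_pre => /(_ on) us.
rewrite pre_relift /c /relift.
have -> : (if n == K then Quasi S else if n == K.+1 then Exit u else Plain)
    = Plain by do ![case: eqP => //]; lia.
have := utree_late _ us; rewrite size_pre => /(_ hn)[e [S' [_ o]]].
rewrite [RHS]surjective_pairing e; congr pair.
case: (leqP m n) => mn; last first.
  case: o => [[T []]//|[u' [[<-] _ _ _]]].
  rewrite /compat /= size_pre /u trunc_pre // size_pre trunc_ge //.
    by move=> /= [].
  by rewrite /= size_pre.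
rewrite h // fixsE //; apply: legalizeE.
by have [] := utree_stepE us.
Qed.

(** The imagined answer is fixed in hindsight: [Exit (pre a m)] if [D] is reached at length [m], and
    otherwise the quasi-strategy [T] of positions from which [D] cannot be forced. *)
Lemma uphi0_lift s a : @legal ugame false s -> play a ->
  follows false (uphi false s) a ->
  exists c, [/\ @play ugame c, @follows ugame false s c &
    forall n, (c n).1 = a n].
Proof.
move=> ls pa fa.
have uK : utree (deco Plain Plain (pre a K)).
  by apply: utree_small (pa _); rewrite size_pre.
have := legal_step ls uK; rewrite size_pre odd_double => /(_ erefl) usK.
have [|S [eS]] := utree_at0 _ usK; first exact: size_pre.
have aK : a K = (s (deco Plain Plain (pre a K))).1.
  by rewrite fa ?odd_double // uphi_copy ?size_pre ?odd_double.
rewrite -aK -/(pre a K.+1) => qS.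
have sK : s (deco Plain Plain (pre a K)) = (a K, Quasi S).
  by rewrite [LHS]surjective_pairing -aK eS.
have qE n : K <= n -> quasi_of (cut s) (trunc K (pre a n)) = S.
  by move=> hn; rewrite /quasi_of trunc_pre // cutE ?sK ?size_deco ?size_pre.
(* The move at length [K.+1] belongs to player true, whom [S] does not restrict. *)
have S2 : S (pre a K.+2).
  apply: (quasi_other qS (quasi_base qS)); last exact: (pa K.+2).
  by rewrite size_pre /= odd_double.
have followK t1 n : n <= K -> odd n = false ->
    relift (Quasi S) t1 a n = s (pre (relift (Quasi S) t1 a) n).
  rewrite leq_eqVlt => /orP[/eqP -> _|hn on]; last first.
    exact: (follow_early _ _ ls pa fa hn on).
  rewrite pre_relift (@deco_irr0 _ _ Plain Plain) ?size_pre // sK /relift.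
  by rewrite eqxx.
pose T := avoids false S D (pre a K.+2).
pose g u p := (fixs s (deco (Quasi S) (Exit u) p)).1.
pose h p := (fixs s (deco (Quasi S) (Quasi T) p)).1.
have qT : ~ forces false S D (pre a K.+2) -> quasi true S (pre a K.+2) T.
  move=> nf; apply: (@avoids_quasi false) => //.
    move=> p Sp; case: (boolP (odd (size p))) => op.
      have [x gx] := gtree_pruned (quasi_sub qS Sp).
      by exists x; exact: (quasi_other qS).
    by apply: (quasi_mine qS Sp); exact/negbTE.
  move=> x p Sx; rewrite size_pre => sp; apply: (quasi_behead qS Sx).
  by rewrite size_pre ltnW.
have okT n : K.+2 <= n -> ~ forces false S D (pre a K.+2) -> T (pre a n) ->
    option_ok S (Quasi T) (pre a n).
  move=> hn nf Tn; left; exists T; split => //.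
    by rewrite trunc_pre //; exact: qT.
  (* A position in [D] forces [D] at once, so none is left in [T]. *)
  move=> q [Sq sq _ /(_ (size q))]; rewrite sq leqnn => /(_ isT) nq Dq.
  apply: nq; rewrite trunc_ge //.
  by apply: (forces_hit _ (gdflt G)) => // p; exact: (quasi_mine qS).
have utT n : K.+2 <= n -> ~ forces false S D (pre a K.+2) -> T (pre a n) ->
    utree (deco (Quasi S) (Quasi T) (pre a n)).
  move=> hn nf Tn; apply/utree_decoP; split=> // _; exists S.
  by split=> [//||_]; [rewrite trunc_pre // ltnW|exact: okT].
have Tn n : K.+2 <= n -> S (pre a n) ->
    (forall m, K.+2 <= m <= n -> ~ forces false S D (pre a m)) -> T (pre a n).
  move=> hn Sn nf; split; rewrite ?size_pre ?trunc_pre // => m hm.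
  by rewrite trunc_pre; [exact: nf|lia].
have hstep n : K.+2 <= n -> odd n = false -> S (pre a n) ->
    (forall m, K.+2 <= m <= n -> ~ forces false S D (pre a m)) ->
    utree (s (deco (Quasi S) (Quasi T) (pre a n)) ::
           deco (Quasi S) (Quasi T) (pre a n)) /\
    T (h (pre a n) :: pre a n).
  move=> hn on Sn nf; have nf2 : ~ forces false S D (pre a K.+2).
    by apply: nf; rewrite leqnn.
  have un := utT n hn nf2 (Tn n hn Sn nf).
  have := legal_step ls un; rewrite size_pre => /(_ on) us; split => //.
  have := utree_late _ us; rewrite size_pre => /(_ hn)[_ [S' [_ o]]].
  by case: o => [[T' [[<-] _ _]]|[u []]//]; rewrite /h fixsE.
have hcond n : K.+2 <= n -> odd n = false -> S (pre a n) ->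
    (forall m, K.+2 <= m <= n -> ~ forces false S D (pre a m)) ->
    S (h (pre a n) :: pre a n).
  by move=> hn on Sn nf; have [_ []] := hstep n hn on Sn nf.
have fcond n : K.+2 <= n -> odd n = false -> a n = legalize (pre a n)
    (combine false S D K.+2 g h (pre a n)).
  move=> hn on; rewrite {1}fa // /uphi size_pre ifN; last by lia.
  by rewrite /phi0 qE ?trunc_pre //; lia.
have [|||[m [hm Dm Sm gm]]|nf] := combine_play _ _ _ pa S2 hcond fcond.
- by move=> p; exact: (quasi_mine qS).
- by move=> p; exact: (quasi_sub qS).
- by move=> p x; exact: (quasi_other qS).
- pose c := relift (Quasi S) (Exit (pre a m)) a.
  have pc : @play ugame c.
    apply: play_relift => // n hn; right; exists (pre a m).
    by split=> //; [rewrite size_pre|exact: compat_pre].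
  exists c; split=> // n on; case: (leqP n K) => hn; first exact: followK.
  apply: (@follow_exit false s S a m) => //; last by move=> mn; exact: gm.
  rewrite ltn_neqAle hn andbT; apply/eqP => e.
  by move: on; rewrite -e /= odd_double.
- pose c := relift (Quasi S) (Quasi T) a.
  have nf2 : ~ forces false S D (pre a K.+2) by have [] := nf K.+2 (leqnn _).
  have Tall n : K.+2 <= n -> T (pre a n).
    move=> hn; apply: Tn => //; first by have [] := nf n hn.
    by move=> m hm; have [|] := nf m; first by lia.
  have pc : @play ugame c.
    by apply: play_relift => // n hn; exact: okT (Tall n hn).
  exists c; split=> // n on; case: (leqP n K) => hn; first exact: followK.
  have hn2 : K.+2 <= n.
    rewrite ltn_neqAle hn andbT; apply/eqP => e.
    by move: on; rewrite -e /= odd_double.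
  have [Sn _ /(_ on) an] := nf n hn2.
  have [|us _] := hstep n hn2 on Sn.
    by move=> m hm; have [|] := nf m; first by lia.
  rewrite pre_relift /c /relift.
  have := utree_late _ us; rewrite size_pre => /(_ hn2)[e _].
  rewrite [RHS]surjective_pairing e an /h fixsE; last exact: utT (Tall n hn2).
  by congr pair; do ![case: eqP => //]; lia.
Qed.

(** If an exit is reached, the imagined announcement is one granting it. If none is ever forced, it
    is [T], and the answer of [s] to [T] must then be a quasi-strategy, which the play obeys. *)
Lemma uphi1_lift s a : @legal ugame true s -> play a ->
  follows true (uphi true s) a ->
  exists c, [/\ @play ugame c, @follows ugame true s c &
    forall n, (c n).1 = a n].
Proof.
move=> ls pa fa; pose q := pre a K.+1; pose E := exits (cut s) q.
have sq : size q = K.+1 by rewrite size_pre.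
have tq n : K.+1 <= n -> trunc K.+1 (pre a n) = q.
  by move=> h; rewrite trunc_pre.
have oK : odd K.+1 = true by rewrite /= odd_double.
have uq S t1 : quasi false (@gtree G) q S -> utree (deco (Quasi S) t1 q).
  move=> qS; apply/utree_decoP; split; first exact: (pa K.+1).
  by move=> _; exists S; split=> //; [rewrite tq|rewrite sq; lia].
have lq t0 t1 : utree (deco t0 t1 q) ->
    utree (s (deco t0 t1 q) :: deco t0 t1 q).
  by move=> h; apply: (@legal_step true) => //; rewrite sq.
have cutq S : quasi false (@gtree G) q S ->
    cut s (deco (Quasi S) Plain q) = s (deco (Quasi S) Plain q).
  by move=> qS; rewrite cutE ?size_deco ?sq //; exact: uq.
have odd_gt n : odd n = true -> K.+1 <= n -> n != K.+1 -> K.+2 <= n.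
  by move=> _ h1 h2; rewrite ltn_neqAle eq_sym h2.
pose T := no_exit (cut s) q.
pose z := s (deco (Quasi T) Plain q).
pose g u p := (fixs s (deco (Quasi (exit_quasi (cut s) q u)) (Exit u) p)).1.
pose h p := legalize p (fixs s (deco (Quasi T)
  (cut s (deco (Quasi T) Plain q)).2 p)).1.
have fcond n : K.+1 <= n -> odd n = true -> a n = legalize (pre a n)
    (combine true (@gtree G) E K.+1 g h (pre a n)).
  move=> hn on; rewrite {1}fa // /uphi size_pre ifN; last by lia.
  by rewrite /phi1 tq.
have hcond n : K.+1 <= n -> odd n = true -> gtree (pre a n) ->
    (forall m, K.+1 <= m <= n -> ~ forces true (@gtree G) E (pre a m)) ->
    gtree (h (pre a n) :: pre a n).
  by move=> _ _ gn _; exact: legalizeP.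
have Gpr p : gtree p -> odd (size p) = true -> exists x, gtree (x :: p).
  by move=> gp _; exact: gtree_pruned.
have [||[m [hm Em _ gm]]|nf] := combine_play Gpr _ _ pa (pa K.+1) hcond fcond;
  rewrite //.
- pose S := exit_quasi (cut s) q (pre a m).
  have [qS] : grants (cut s) q (pre a m) S by exact: pick_suchP.
  rewrite cutq // => eS; have us := lq _ _ (uq S Plain qS).
  have [S' [[<-] o]] := utree_at1 sq us.
  case: o => [[?]|[u []]]; first by rewrite eS => -[].
  rewrite eS => -[<-] Su Du su cu; rewrite size_pre in su.
  (* The granted exit is compatible with the move made together with the mark, and the play passes
     through the exit. *)
  have aK : a K.+1 = (s (deco (Quasi S) Plain q)).1.
    have su' : size ((s (deco (Quasi S) Plain q)).1 :: q) = K.+2.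
      by rewrite -[LHS]/(size q).+1 sq.
    move: cu; rewrite /compat su' size_pre trunc_pre // trunc_ge ?su' //.
    by case.
  pose c := relift (Quasi S) (Exit (pre a m)) a.
  have pc : @play ugame c.
    apply: play_relift => // n hn; right; exists (pre a m).
    by split=> //; [rewrite size_pre|exact: compat_pre].
  exists c; split=> // n on; case: (ltngtP n K) on => hn on.
  + exact: (follow_early _ _ ls pa fa hn on).
  + case: (eqVneq n K.+1) => [->|nK].
      rewrite pre_relift /c /relift -/q (@deco_irr1 _ _ Plain) ?sq //.
      rewrite [RHS]surjective_pairing -aK eS eqxx.
      by case: eqP => //; lia.
    apply: (@follow_exit true s S a m) => //; first exact: odd_gt.
    by move=> mn; exact: gm.
  + by rewrite hn odd_double in on.
have nfq : ~ forces true (@gtree G) E q by have [] := nf K.+1 (leqnn _).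
have qT : quasi false (@gtree G) q T.
  apply: (@avoids_quasi true) => //; last exact: (pa K.+1).
    exact: gtree_pruned.
  by move=> x p gx _; exact: gtree_behead gx.
have us := lq _ _ (uq T Plain qT).
have [T' [[<-] o]] := utree_at1 sq us.
have tz : trunc K.+2 (z.1 :: q) = z.1 :: q.
  by rewrite trunc_ge // -[size _]/(size q).+1 sq.
(* An answer [Exit u] would put the exit [u] itself into [T], whose positions force no exit. *)
case: o => [[S [eS]]|[u [eu [gu su _ nu]]]]; last first.
  move=> _ _ _; exfalso; apply: (nu (size u)); first by rewrite su leqnn.
  rewrite trunc_ge //; apply: (forces_hit Gpr (gdflt G)).
  by exists T; split => //; rewrite cutq.
rewrite tz => qS nD Sz.
have aK : a K.+1 = z.1.
  have [_ _ ->] := nf K.+1 (leqnn _) => //.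
  rewrite /h cutq // fixsE; last exact: uq.
  rewrite -/q (@deco_irr1 _ _ Plain) ?sq // legalizeE //.
  by have [] := utree_stepE us.
have eq2 : z.1 :: q = pre a K.+2 by rewrite /= aK.
rewrite eq2 in qS Sz.
have utS n : K.+2 <= n -> S (pre a n) ->
    utree (deco (Quasi T) (Quasi S) (pre a n)).
  move=> hn Sn; apply/utree_decoP; split; first exact: pa.
  move=> _; exists T; split=> // [|_]; first by rewrite trunc_pre // ltnW.
  by left; exists S; split=> //; rewrite trunc_pre.
have step n : K.+2 <= n -> odd n = true -> S (pre a n) ->
    (a n, Plain) = s (deco (Quasi T) (Quasi S) (pre a n)) /\
    S (pre a n.+1).
  move=> hn on Sn; have un := utS n hn Sn.
  have usn := legal_step ls un; rewrite size_pre in usn.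
  have {}usn := usn on.
  have := utree_late _ usn; rewrite size_pre => /(_ hn)[e [S' [_ o]]].
  have an : a n = (s (deco (Quasi T) (Quasi S) (pre a n))).1.
    have [_ _ ->] := nf n (ltnW hn) => //.
    rewrite /h cutq // eS fixsE // legalizeE //.
    by have [] := utree_stepE usn.
  split; first by rewrite [RHS]surjective_pairing e -an.
  by case: o => [[S'' [[<-] _ _]]|[u []]//]; rewrite -an.
(* [S] leaves player false free within [T], and his moves stay in [T] because no exit is ever
   forced. *)
have Sall n : K.+2 <= n -> S (pre a n).
  elim: n => // n IH; rewrite leq_eqVlt => /orP[/eqP <-//|].
  rewrite ltnS => hn; have Sn := IH hn.
  case: (boolP (odd n)) => on; first by have [] := step n hn on Sn.
  apply: (quasi_other qS Sn); first by rewrite size_pre; exact/negbTE.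
  have [gn _ _] := nf n.+1 (leqW (ltnW hn)).
  split; first exact: gn.
  - by rewrite sq -/(pre a n.+1) size_pre; lia.
  - by rewrite -/(pre a n.+1) sq tq //; lia.
  - move=> m; rewrite sq -/(pre a n.+1) size_pre => hm.
    rewrite trunc_pre; last by lia.
    by have [|] := nf m; first by lia.
pose c := relift (Quasi T) (Quasi S) a.
have pc : @play ugame c.
  apply: play_relift => // n hn; left; exists S; split=> //; last exact: Sall.
  by rewrite trunc_pre.
exists c; split=> // n on; case: (ltngtP n K) on => hn on.
- exact: (follow_early _ _ ls pa fa hn on).
- rewrite pre_relift; case: (eqVneq n K.+1) => [->|nK].
    rewrite /c /relift -/q (@deco_irr1 _ _ Plain) ?sq //.
    rewrite -/z [RHS]surjective_pairing -aK eS eqxx.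
    by case: eqP => //; lia.
  have hn2 := odd_gt n on hn nK.
  have [<- _] := step n hn2 on (Sall n hn2).
  by rewrite /c /relift; do ![case: eqP => //]; lia.
- by rewrite hn odd_double in on.
Qed.

Lemma map_Plain p : size p <= K ->
  map (fun x => (x, Plain)) p = deco Plain Plain p.
Proof.
elim: p => //= x p IH hp; rewrite IH //; last exact: ltnW.
by do ![case: eqP => //].
Qed.

Let NK : N <= K. Proof. by rewrite -addnn leq_addr. Qed.

Definition ucovering : covering N ugame G.
Proof.
exists (fst : ugame -> G) (fun x => (x, Plain) : ugame) uphi => //.
- by move=> p [].
- move=> p sp gp; rewrite map_Plain ?(leq_trans sp) //.
  exact: utree_small (leq_trans sp NK) gp.
- move=> p sp [gp [t0 [t1 [e _]]]].
  have sp' : size (map fst p) <= K by rewrite size_map (leq_trans sp).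
  by rewrite map_Plain // [in RHS]e; exact: deco_irr0.
- exact: uphi_legal.
- by move=> b s t n _ _; exact: uphi_local.
- move=> b s p ls gp sp op; rewrite uphi_copy // ?map_Plain //;
    exact: leq_trans (ltnW sp) NK.
- by move=> [] s a; [exact: uphi1_lift|exact: uphi0_lift].
Defined.

(** An announced exit lies in [D] and the play must run through it, whereas a quasi-strategy
    answered instead contains no position of [D]. *)
Lemma ucovering_D c : @play ugame c ->
  (exists n, D (pre (fst \o c) n)) <-> exists u, (c K.+1).2 = Exit u.
Proof.
move=> pc; pose a := fst \o c.
have pa : play a by move=> n; rewrite -(map_pre _ c); have [] := pc n.
have uc n : exists t0 t1, pre c n = deco t0 t1 (pre a n) /\
    tags_ok t0 t1 (pre a n).
  by have [_ [t0 [t1]]] := pc n; rewrite map_pre; exists t0, t1.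
have Dup m n : m <= n -> D (pre a m) -> D (pre a n).
  elim: n => [|n IH]; first by case: m.
  rewrite leq_eqVlt => /orP[/eqP ->//|hm Dm].
  by apply: D_up; [exact: (pa n.+1)|exact: IH].
have [t0 [t1 [e2 h2]]] := uc K.+2.
have [|S [eS qS o]] := h2; first by rewrite size_pre.
have := o; rewrite size_pre => /(_ (ltnSn _)) {}o.
have c1 : (c K.+1).2 = t1.
  move: e2 => /= [-> _ _]; rewrite size_pre /=.
  by case: eqP => [|_]; [lia|rewrite eqxx].
have later n : K.+2 <= n -> option_ok S t1 (pre a n).
  move=> hn; have [t0' [t1' [e h]]] := uc n.
  have [|S' [eS' qS' o']] := h; first by rewrite size_pre; lia.
  have := o'; rewrite size_pre => /(_ hn) {}o'.
  have e' : pre c K.+2 = deco t0' t1' (pre a K.+2).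
    have dt p : deco t0' t1' (trunc K.+2 p) = trunc K.+2 (deco t0' t1' p).
      elim: p => //= x p IH; case: (leqP K.+2 (size p)) => sp.
        by rewrite !trunc_cons ?size_deco.
      by rewrite !trunc_ge //= ?size_deco.
    by rewrite -(trunc_pre c hn) e -dt trunc_pre.
  have e0 : t0 = t0'.
    by apply: deco_inj0 (etrans (esym e2) e'); rewrite size_pre.
  have e1 : t1 = t1'.
    by apply: deco_inj1 (etrans (esym e2) e'); rewrite size_pre.
  by move: eS'; rewrite -e0 eS => -[->]; rewrite e1.
rewrite c1; split=> [[n Dn]|[u eu]].
  have Dm : D (pre a (maxn n K.+2)) by apply: Dup Dn; rewrite leq_maxl.
  case: (later (maxn n K.+2)) => [|[T [_ _ nD Tn]]|[u [-> _ _ _ _]]].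
  - by rewrite leq_maxr.
  - by case: (nD _ Tn).
  - by exists u.
exists (maxn (size u) K.+2).
case: (later (maxn (size u) K.+2)) => [|[T []]|[u' []]].
- by rewrite leq_maxr.
- by rewrite eu.
- rewrite eu => -[<-] _ Du _; rewrite /compat size_pre.
  rewrite trunc_ge ?leq_maxl // trunc_pre ?leq_maxl // => eu'.
  by apply: (@Dup (size u)); rewrite ?leq_maxl // -eu'.
Qed.

End Unravel.

Lemma unravel_open (G : game) N (D : seq G -> Prop) :
  (forall x p, gtree (x :: p) -> D p -> D (x :: p)) ->
  exists H (c : covering N H G),
    clopen_on (fun a : nat -> H => exists n, D (pre (cf c \o a) n)).
Proof.
move=> Dup; exists (ugame N D), (ucovering N D) => a pa.
(* These moves include the deciding mark, made at length [N.*2.+1]. *)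
exists N.*2.+2 => b pb e.
have [a1 a2] := ucovering_D Dup pa; have [b1 b2] := ucovering_D Dup pb.
rewrite (pre_inj e (ltnSn _)) in b1 b2.
by split=> h; [exact: b2 (a1 h)|exact: a2 (b1 h)].
Qed.

(** * Limits of coverings *)

Fixpoint climb (F : nat -> Type) (s : forall i, F i -> F i.+1) (y : F 0) j :
  F j := if j is j'.+1 then s j' (climb s y j') else y.

(* The thread through y in F i, going down with f and up with s; shifting the
   whole family in the recursion avoids casts. *)
Fixpoint thread i : forall (F : nat -> Type) (f : forall i, F i.+1 -> F i)
    (s : forall i, F i -> F i.+1), F i -> forall j, F j :=
  match i with
  | 0 => fun F f s y => climb s y
  | i'.+1 => fun F f s y j =>
    let z := @thread i' (fun j => F j.+1) (fun j => f j.+1)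
               (fun j => s j.+1) y in
    match j with 0 => f 0 (z 0) | j'.+1 => z j' end
  end.

Section Thread.
Context (F : nat -> Type) (f : forall i, F i.+1 -> F i).
Context (s : forall i, F i -> F i.+1).

Lemma thread_id i y : thread f s y i = y :> F i.
Proof. by elim: i F f s y => //= i IH F' f' s' y; rewrite IH. Qed.

Lemma thread_up i j (y : F i) : i <= j ->
  thread f s y j.+1 = s (thread f s y j).
Proof.
elim: i j F f s y => //= i IH [|j] // F' f' s' y /= hij.
exact: (IH j (fun j => F' j.+1)).
Qed.

Context (sK : forall i, cancel (@s i) (@f i)).

Lemma thread_down i j (y : F i) : f (thread f s y j.+1) = thread f s y j.
Proof.
elim: i j F f s sK y => [|i IH] j F' f' s' sK' y; first by rewrite /= sK'.
case: j => [|j] //=; apply: (IH j (fun j => F' j.+1)) => k; exact: sK'.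
Qed.

Lemma thread_uniq i (z : forall j, F j) : (forall j, f (z j.+1) = z j) ->
  (forall j, i <= j -> z j.+1 = s (z j)) -> thread f s (z i) = z.
Proof.
move=> zd zu; apply: functional_extensionality_dep => j.
have up d : thread f s (z i) (d + i) = z (d + i).
  elim: d => [|d IH]; first by rewrite add0n thread_id.
  by rewrite addSn thread_up ?leq_addl // IH zu ?leq_addl.
case: (leqP i j) => [hij|]; first by rewrite -(subnK hij) up.
elim: {j}(i - j.+1) {-2}j (erefl (i - j.+1)) => [|d IH] j hd hj.
  have e : i = j.+1 by lia.
  by subst i; rewrite -thread_down thread_id zd.
by rewrite -thread_down IH ?zd //; lia.
Qed.

End Thread.

(** * The inverse limit of a sequence of coverings *)

Section Limit.
Context (N : nat) (Gs : nat -> game).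
Context (c : forall i, covering (N + i) (Gs i.+1) (Gs i)).

Definition lmove := forall i, Gs i.
Definition lproj i (x : lmove) := x i.
Definition lthread i (y : Gs i) : lmove :=
  thread (fun i => cf (c i)) (fun i => cs (c i)) y.
Local Notation proj i := (map (lproj i)).
Local Notation thr i := (map (@lthread i)).
Implicit Types (p : seq lmove) (s t : seq lmove -> lmove) (b : bool).

Definition ltree p := forall i, gtree (proj i p) /\
  map (cf (c i)) (proj i.+1 p) = proj i p.

Lemma cfK i : cancel (cs (c i)) (cf (c i)).
Proof. exact: c_csK. Qed.

Lemma thrK i q : proj i (thr i q) = q.
Proof. by elim: q => //= x q ->; rewrite /lproj /lthread thread_id. Qed.

Lemma thr_down i j q :
  map (cf (c j)) (proj j.+1 (thr i q)) = proj j (thr i q).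
Proof.
elim: q => //= x q ->; congr cons; rewrite /lproj /lthread.
exact: (@thread_down Gs (fun i => cf (c i)) (fun i => cs (c i)) cfK).
Qed.

Lemma thr_up i j q : i <= j ->
  proj j.+1 (thr i q) = map (cs (c j)) (proj j (thr i q)).
Proof.
move=> hij; elim: q => //= x q ->; congr cons.
exact: (@thread_up Gs (fun i => cf (c i)) (fun i => cs (c i))).
Qed.

(** At this length all games from level [i] on have the same positions by [c_lowK], and the lower
    levels are projections. *)
Lemma projK i p : size p <= N + i -> ltree p -> thr i (proj i p) = p.
Proof.
move=> sp lp.
have up j : i <= j -> proj j.+1 p = map (cs (c j)) (proj j p).
  move=> hij; have [gp <-] := lp j.
  rewrite c_lowK ?size_map //.
    by apply: leq_trans sp _; rewrite leq_add2l.
  by have [] := lp j.+1.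
have dn j : map (cf (c j)) (proj j.+1 p) = proj j p by have [] := lp j.
elim: p up dn {lp sp} => //= x p IH up dn; rewrite IH.
- congr cons; apply: (@thread_uniq Gs _ _ cfK) => j.
    by have [] := dn j.
  by move=> hij; have [] := up j hij.
- by move=> j hij; have [] := up j hij.
- by move=> j; have [] := dn j.
Qed.

Lemma ltree_thr i q : size q <= N + i -> gtree q -> ltree (thr i q).
Proof.
move=> sq gq j; split; last exact: thr_down.
have up d : gtree (proj (d + i) (thr i q)).
  elim: d => [|d IH]; first by rewrite add0n thrK.
  rewrite addSn thr_up ?leq_addl //; apply: c_low => //.
  by rewrite !size_map; lia.
case: (leqP i j) => [hij|]; first by rewrite -(subnK hij).
elim: {j}(i - j.+1) {-2}j (erefl (i - j.+1)) => [|d IH] j hd hj.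
  rewrite -thr_down; apply: c_tree; have -> : j.+1 = i by lia.
  by rewrite thrK.
by rewrite -thr_down; apply: c_tree; apply: IH; lia.
Qed.

Lemma ltree_nil : ltree [::].
Proof. by move=> i; split => //; exact: gtree_nil. Qed.

Lemma ltree_behead x p : ltree (x :: p) -> ltree p.
Proof.
move=> lp i; have [g [_ e]] := lp i; split=> //; exact: gtree_behead g.
Qed.

Lemma ltree_pruned p : ltree p -> exists x, ltree (x :: p).
Proof.
move=> lp; have [gp _] := lp (size p).+1; have [x gx] := gtree_pruned gp.
exists (lthread x); have := ltree_thr _ gx.
by rewrite /= projK //; [apply; rewrite size_map; lia|lia].
Qed.

Definition lgame : game :=
  @Game lmove ltree ltree_nil ltree_behead ltree_pruned.

(** The strategy read off from the limit at level [i + d] and pushed down [d] coverings; by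
    [lpsi_stable] its value at [q] is independent of [d] once [size q < N + i + d]. *)
Fixpoint lpsi b s d i : seq (Gs i) -> Gs i :=
  if d is d'.+1 then cphi (c i) b (@lpsi b s d' i.+1) else
  fun q => legalize q
    (if pselect (ltree (thr i q)) then lproj i (s (thr i q)) else gdflt _).

Arguments lpsi : clear implicits.

Definition lphi b s i q := lpsi b s (size q).+1 i q.

Lemma lpsi_legal b s d i : legal b (lpsi b s d i).
Proof.
elim: d i => [|d IH] i /=; last exact: c_legal.
by move=> q gq _; exact: legalizeP.
Qed.

Arguments lpsi_legal : clear implicits.

Lemma lphi_legal b s i : legal b (@lphi b s i).
Proof. by move=> q gq oq; exact: (lpsi_legal b s _ i). Qed.

Lemma lpsi0 b s i q : @legal lgame b s -> gtree q -> size q <= N + i ->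
  odd (size q) = b -> lpsi b s 0 i q = lproj i (s (thr i q)).
Proof.
move=> ls gq sq oq /=; have lq := ltree_thr sq gq.
case: pselect => [l|nl] //=; apply: legalizeE.
have /= /(_ lq) ll := ls (thr i q).
by have := ll; rewrite size_map => /(_ oq i)[/=]; rewrite thrK.
Qed.

Lemma thr_cs i q : thr i.+1 (map (cs (c i)) q) = thr i q.
Proof.
elim: q => //= x q ->; congr cons.
have -> : cs (c i) x = lthread x i.+1.
  rewrite /lthread (@thread_up Gs (fun i => cf (c i)) (fun i => cs (c i))) //.
  by rewrite thread_id.
apply: (@thread_uniq Gs _ _ cfK) => j.
  exact: (@thread_down Gs (fun i => cf (c i)) (fun i => cs (c i)) cfK).
move=> hij; apply: (@thread_up Gs (fun i => cf (c i)) (fun i => cs (c i))).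
exact: ltnW.
Qed.

(** For [d = 0] the covering [c i] copies moves at this length; locality carries the equality down
    through further coverings. *)
Lemma lpsi_stable b s d i q : @legal lgame b s -> gtree q ->
  size q < N + i + d -> odd (size q) = b -> lpsi b s d.+1 i q = lpsi b s d i q.
Proof.
move=> ls; elim: d i q => [|d IH] i q gq sq oq.
  rewrite addn0 in sq.
  have gcq : gtree (map (cs (c i)) q) by apply: c_low => //; exact: ltnW.
  have lq := ltree_thr (ltnW sq) gq.
  rewrite lpsi0 // ?(ltnW sq) // [LHS](c_copy _ (lpsi_legal b s 0 i.+1)) //.
  rewrite lpsi0 // ?size_map ?thr_cs //; last by lia.
  have /= /(_ lq) := ls (thr i q).
  by rewrite size_map => /(_ oq i)[_ [->]].
rewrite [LHS](c_local (n := size q) _ (lpsi_legal b s d.+1 i.+1)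
  (lpsi_legal b s d i.+1)) //.
by move=> q' gq' sq' oq'; apply: IH => //; lia.
Qed.

Lemma lpsi_stableD b s d e i q : @legal lgame b s -> gtree q ->
  size q < N + i + d -> odd (size q) = b ->
  lpsi b s (e + d) i q = lpsi b s d i q.
Proof.
move=> ls gq sq oq; elim: e => // e IH.
by rewrite addSn lpsi_stable // addnA; lia.
Qed.

Lemma lphi_step b s i q : @legal lgame b s -> gtree q -> odd (size q) = b ->
  lphi b s q = cphi (c i) b (@lphi b s i.+1) q.
Proof.
move=> ls gq oq; rewrite /lphi -lpsi_stable //; last by lia.
apply: (c_local (n := size q) _ (lpsi_legal b s (size q).+1 i.+1)
  (@lphi_legal b s i.+1)) => //.
move=> q' gq' sq' oq'; rewrite /lphi -(subnK sq').
by rewrite -addnS lpsi_stableD //; lia.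
Qed.

Lemma lphi_copy b s i q : @legal lgame b s -> gtree q -> size q < N + i ->
  odd (size q) = b -> lphi b s q = lproj i (s (thr i q)).
Proof.
move=> ls gq sq oq; rewrite /lphi -[(size q).+1]addn0.
by rewrite lpsi_stableD ?addn0 // lpsi0 // ltnW.
Qed.

Lemma lpsi_local b s t n d i q : 
  (forall p, ltree p -> size p <= n -> odd (size p) = b -> s p = t p) ->
  gtree q -> size q <= n -> odd (size q) = b ->
  lpsi b s d i q = lpsi b t d i q.
Proof.
move=> h; elim: d i q => [|d IH] i q gq sq oq /=.
  by case: pselect => [l|nl] //=; rewrite h ?size_map.
apply: (c_local (n := n) _ (lpsi_legal b s d i.+1)
  (lpsi_legal b t d i.+1)) => //.
by move=> q' gq' sq' oq'; exact: IH.
Qed.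

(** Lifting level by level gives a coherent family of plays, that is, a play of the limit. *)
Lemma lphi_lift b s (a : nat -> Gs 0) : @legal lgame b s -> play a ->
  follows b (@lphi b s 0) a ->
  exists z, [/\ @play lgame z, @follows lgame b s z &
    forall n, lproj 0 (z n) = a n].
Proof.
move=> ls pa fa.
pose P i := {x : nat -> Gs i | play x /\ follows b (@lphi b s i) x}.
have next i (x : P i) : {y : P i.+1 | forall n, cf (c i) (sval y n) = sval x n}.
  apply: cid; case: x => x [px fx] /=.
  have fx' : follows b (cphi (c i) b (@lphi b s i.+1)) x.
    move=> n on; rewrite {1}fx // lphi_step ?size_pre //; exact: px.
  have [y [py fy ey]] := c_lift (@lphi_legal b s i.+1) px fx'.
  by exists (exist _ y (conj py fy)).
pose fix lifts i : P i := if i is j.+1 then sval (next j (lifts j)) else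
  exist _ a (conj pa fa).
pose z n : lmove := fun i => sval (lifts i) n.
have ez i n : proj i (pre z n) = pre (sval (lifts i)) n by rewrite map_pre.
have pz : @play lgame z.
  move=> n i; rewrite !ez; split.
    by have [p _] := svalP (lifts i); exact: p.
  rewrite map_pre; apply: eq_pre => m _ /=.
  exact: (svalP (next i (lifts i))).
exists z; split=> //.
move=> n on; have up := ls (pre z n) (pz n).
rewrite size_pre in up; have {}up : ltree _ := up on.
(* At high levels [lphi] copies [s]; projecting from there settles the lower levels. *)
have high i : n < N + i -> z n i = s (pre z n) i.
  move=> hn; have [px fx] := svalP (lifts i).
  rewrite /z fx // lphi_copy ?size_pre //.
  by rewrite -ez projK // ?size_pre ?(ltnW hn) //; exact: pz.
apply: functional_extensionality_dep => i.
have down j : s (pre z n) j = cf (c j) (s (pre z n) j.+1).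
  by have [_ [e _]] := up j; rewrite -[LHS]e.
have downz j : z n j = cf (c j) (z n j.+1).
  by rewrite /z /= (svalP (next j (lifts j))).
have : z n (n.+1 + i) = s (pre z n) (n.+1 + i) by apply: high; lia.
elim: (n.+1) => // d IH; rewrite addSn => e; apply: IH.
by rewrite down downz e.
Qed.

Definition lcovering : covering N lgame (Gs 0).
Proof.
exists (lproj 0 : lgame -> Gs 0) (@lthread 0 : Gs 0 -> lgame)
  (fun b s => @lphi b s 0).
- by move=> x; rewrite /lproj /lthread thread_id.
- by move=> p lp; have [] := lp 0.
- by move=> p sp gp; apply: ltree_thr; rewrite ?addn0.
- by move=> p sp lp; apply: projK; rewrite ?addn0.
- by move=> b s _; exact: lphi_legal.
- move=> b s t n _ _ h p gp sp op; exact: (lpsi_local _ h).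
- by move=> b s p ls gp sp op; apply: lphi_copy; rewrite ?addn0.
- by move=> b s a ls pa fa; exact: lphi_lift.
Defined.

Lemma lproj_play i (a : nat -> lgame) : play a -> play (lproj i \o a).
Proof. by move=> pa n; rewrite -(map_pre _ a); have [] := pa n i. Qed.

Lemma lproj_down i (a : nat -> lgame) n : play a ->
  cf (c i) (lproj i.+1 (a n)) = lproj i (a n).
Proof. by move=> pa; have [_ [->]] := pa n.+1 i. Qed.

End Limit.

(** * Borel determinacy *)

Section Unravelable.
Context {X : Type}.
Implicit Types (A : set (nat -> X)).

(** Allowing all games with moves labelled in [X] lets the property be used again in a covering
    game, labelled through the projection. *)
Definition unravelable A := forall (G : game) (g : G -> X) N,
  exists H (c : covering N H G),
    clopen_on (fun a : nat -> H => A (g \o (cf c \o a))).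

Lemma clopen_ext (G : game) (A B : (nat -> G) -> Prop) :
  (forall a, play a -> (A a <-> B a)) -> clopen_on A -> clopen_on B.
Proof.
move=> AB cA a pa; have [n hn] := cA a pa; exists n => b pb e.
have [h1 h2] := hn b pb e; have [h3 h4] := AB a pa; have [h5 h6] := AB b pb.
by split=> h; [exact/h5/h1/h4|exact/h3/h2/h6].
Qed.

Definition open_plays A := forall a, A a ->
  exists n, forall b, pre b n = pre a n -> A b.

Lemma unravelable_open A : open_plays A -> unravelable A.
Proof.
move=> oA G g N.
pose D (q : seq G) := forall b, pre b (size q) = map g q -> A b.
have [|H [c cD]] := @unravel_open G N D.
  by move=> x p _ Dp b /= [_ e]; exact: Dp.
exists H, c; apply: clopen_ext cD => a pa; split=> [[n]|/oA[n hn]].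
  by apply; rewrite size_pre map_pre.
by exists n => b; rewrite size_pre map_pre; exact: hn.
Qed.

Lemma unravelableC A : unravelable A -> unravelable (~` A).
Proof.
move=> uA G g N; have [H [c cA]] := uA G g N; exists H, c => a pa.
have [n hn] := cA a pa; exists n => b pb e.
by have [h1 h2] := hn b pb e; split=> h h'; apply: h; [exact: h2|exact: h1].
Qed.

(** The sets are unravelled in turn, [A i] by a covering that copies up to length [N + i]. In the
    limit each is clopen, so the union is open and one more covering unravels it. *)
Lemma unravelable_bigcup (A : nat -> set (nat -> X)) :
  (forall i, unravelable (A i)) -> unravelable (\bigcup_i A i).
Proof.
move=> uA G g N.
pose stage := {G : game & G -> X}.
have step i (S : stage) : {Hc : {H : game & covering (N + i) H (projT1 S)} |
    clopen_on (fun a : nat -> projT1 Hc =>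
      A i (projT2 S \o (cf (projT2 Hc) \o a)))}.
  apply: cid; have [H [c cA]] := uA i _ (projT2 S) (N + i).
  by exists (existT _ H c).
pose fix st i : stage := if i is j.+1 then
  existT (fun H : game => H -> X) (projT1 (sval (step j (st j))))
    (projT2 (st j) \o cf (projT2 (sval (step j (st j)))))
  else existT (fun H : game => H -> X) G g.
pose Gs i := projT1 (st i).
pose c i : covering (N + i) (Gs i.+1) (Gs i) := projT2 (sval (step i (st i))).
pose L := lgame c; pose C := lcovering c.
have base i (a : nat -> L) : play a ->
    projT2 (st i) \o (@lproj Gs i \o a) = g \o (@lproj Gs 0 \o a).
  move=> pa; elim: i => // i <-; apply: funext => n /=; congr (projT2 (st i) _).
  exact: (lproj_down i n pa).
pose U (a : nat -> L) := (\bigcup_i A i) (g \o (@lproj Gs 0 \o a)).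
pose D (q : seq L) := forall b, play b -> pre b (size q) = q -> U b.
have DU a : play a -> (exists n, D (pre a n)) <-> U a.
  move=> pa; split=> [[n]|]; first by apply; rewrite ?size_pre.
  case=> i _ Ai; rewrite -(base i.+1) // in Ai.
  have [n hn] := svalP (step i (st i)) _ (lproj_play i.+1 pa).
  exists n => b pb; rewrite size_pre => e; exists i => //.
  rewrite -(base i.+1) //; apply/(hn _ (lproj_play i.+1 pb)) => //.
  by rewrite -(map_pre _ b) -(map_pre _ a) e.
have [|H [d cD]] := @unravel_open L N D.
  by move=> x p _ Dp b pb [_ e]; exact: Dp.
exists H, (covering_comp d C); apply: clopen_ext cD => a pa.
exact: DU (play_cf d pa).
Qed.

Lemma unravelable_borel (T : topologicalType) (dec : (nat -> X) -> T) :
  (forall O, open O -> open_plays (dec @^-1` O)) ->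
  forall B, borel B -> unravelable (dec @^-1` B).
Proof.
move=> od; suff : borel (T := T) `<=` [set B | unravelable (dec @^-1` B)] by [].
apply: smallest_sub; last by move=> O oO; exact/unravelable_open/od.
split=> /=.
- by apply: unravelable_open => a; rewrite preimage_set0.
- by move=> B uB; rewrite setTD preimage_setC; exact: unravelableC.
- by move=> F uF; rewrite preimage_bigcup; exact: unravelable_bigcup.
Qed.

End Unravelable.

(** If player false cannot force a position that settles [A] in his favour, player true keeps to
    positions from which this is impossible; a play in [A] would contain a settling position. *)
Lemma clopen_determinacy (G : game) (A : (nat -> G) -> Prop) : clopen_on A ->
  (exists2 s, legal false s & forall a, play a -> follows false s a -> A a) \/
  (exists2 s, legal true s & forall a, play a -> follows true s a -> ~ A a).
Proof.
move=> cA.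
pose U (p : seq G) := forall b, play b -> pre b (size p) = p -> A b.
have gpr b (p : seq G) : gtree p -> odd (size p) = b ->
    exists x, gtree (x :: p).
  by move=> gp _; exact: gtree_pruned.
have [[s ls ws]|nf] := pselect (forces false (@gtree G) U [::]).
  left; exists s => // a pa fa; have [||n hn on|n _] := ws a => //.
    exact: fa.
  by apply; rewrite ?size_pre.
right; set T := avoids false (@gtree G) U [::].
have qT : quasi true (@gtree G) [::] T.
  apply: (@avoids_quasi G false) => //; last exact: gtree_nil.
    exact: gtree_pruned.
  by move=> x p gx _; exact: gtree_behead gx.
have h p : exists x, gtree p -> gtree (x :: p) /\
    (T p -> odd (size p) = true -> T (x :: p)).
  have [[Tp op]|nT] := pselect (T p /\ odd (size p) = true).
    have [x Tx] := quasi_mine qT Tp op; exists x => _.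
    by split=> //; exact: (quasi_sub qT).
  have [gp|ngp] := pselect (gtree p); last by exists (gdflt G).
  have [x gx] := gtree_pruned gp; exists x => _; split => // Tp op.
  by case: nT.
have [s hs] := choice h; exists s => [p gp _|a pa fa Aa].
  by have [] := hs p gp.
have Tn n : T (pre a n).
  elim: n => [|n IH]; first exact: (quasi_base qT).
  case: (boolP (odd n)) => on.
    by rewrite /= fa //; have [_] := hs _ (pa n); apply; rewrite ?size_pre.
  apply: (quasi_other qT) => //; last exact: (pa n.+1).
  by rewrite size_pre; exact/negbTE.
have [n hn] := cA a pa; have [_ _ _ /(_ n)] := Tn n.
rewrite /= size_pre leqnn => /(_ isT); rewrite trunc_ge ?size_pre //; apply.
apply: (forces_hit (gpr false) (gdflt G)) => b pb; rewrite size_pre => e.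
by apply/(hn b pb e).
Qed.

Lemma unravelable_determinacy (G : game) (A : set (nat -> G)) : unravelable A ->
  (exists2 s, legal false s & forall a, play a -> follows false s a -> A a) \/
  (exists2 s, legal true s & forall a, play a -> follows true s a -> ~ A a).
Proof.
move=> uA; have [H [c cA]] := uA G id 0.
have fold (a : nat -> G) (a' : nat -> H) :
    (forall n, cf c (a' n) = a n) -> id \o (cf c \o a') = a.
  by move=> e; apply: funext.
have [[s ls ws]|[s ls ws]] := clopen_determinacy cA; [left|right].
  exists (cphi c false s); first exact: c_legal.
  move=> a pa fa; have [a' [pa' fa' /fold <-]] := c_lift ls pa fa.
  exact: ws.
exists (cphi c true s); first exact: c_legal.
move=> a pa fa; have [a' [pa' fa' /fold <-]] := c_lift ls pa fa.
exact: ws.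
Qed.

(* Two players fill in a function y : C -> bool; the value at c is chosen at
   time turn c, by player false if turn c is even, knowing the values at the
   coordinates of smaller turn. *)
Section CoordinateGame.
Context {C : Type} (turn : C -> nat).
Implicit Types (y z : C -> bool).

Definition below y t : C -> bool := fun c => y c && (turn c < t).

Definition plays_by b (s : C -> (C -> bool) -> bool) y :=
  forall c, odd (turn c) = b -> y c = s c (below y (turn c)).

(** A move fills in all coordinates of one turn at once and is [false] elsewhere, which gives all
    turns the same type of moves. *)
Fixpoint ctree (p : seq (C -> bool)) : Prop := if p is x :: p' then
  (forall c, turn c <> size p' -> x c = false) /\ ctree p' else True.

Lemma ctree_pruned p : ctree p -> exists x, ctree (x :: p).
Proof. by move=> cp; exists (fun _ => false). Qed.

Definition cgame : game := @Game (C -> bool) ctree I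
  (fun x p => @proj2 _ _) ctree_pruned.

Definition layer y t : C -> bool := fun c => y c && (turn c == t).

Lemma coordinate_determinacy (A : set (C -> bool)) :
  unravelable [set a : nat -> C -> bool | A (fun c => a (turn c) c)] ->
  (exists s, forall y, plays_by false s y -> A y) \/
  (exists s, forall y, plays_by true s y -> ~ A y).
Proof.
move=> uA.
have pl y : @play cgame (layer y).
  elim=> //= n IH; split=> // c; rewrite size_pre => h.
  by rewrite /layer; case: eqP => //; rewrite andbF.
have dl y : (fun c => layer y (turn c) c) = y.
  by apply: funext => c; rewrite /layer eqxx andbT.
have key b s y : @legal cgame b s ->
    plays_by b (fun c z => s (pre (layer z) (turn c)) c) y ->
    @follows cgame b s (layer y).
  move=> ls py n on; apply: funext => c; rewrite {1}/layer.
  case: eqP => [e|ne]; last first.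
    have := ls (pre (layer y) n) (pl y n); rewrite size_pre => /(_ on)[/= h _].
    by rewrite h ?size_pre // andbF.
  rewrite andbT py e //; congr (s _ c).
  apply: eq_pre => m lm; apply: funext => d; rewrite /layer /below.
  by case: eqP => [->|]; rewrite ?andbF // lm andbT.
have [[s ls ws]|[s ls ws]] := @unravelable_determinacy cgame _ uA;
  [left|right]; exists (fun c z => s (pre (layer z) (turn c)) c) => y py.
  by rewrite -(dl y); apply: ws => //; exact: key.
by rewrite -(dl y); apply: ws => //; exact: key.
Qed.

End CoordinateGame.

(** * Topology of shift spaces *)

Lemma prod_cvg I (K : I -> topologicalType) (F : set_system (prod_topology K))
    (t : prod_topology K) : Filter F ->
  (forall i B, open B -> B (t i) -> F [set x | B (x i)]) -> F --> t.
Proof.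
move=> FF h; apply/cvg_sup => i A.
rewrite (@nbhsE (initial_topology (fun f : forall i, K i => f i))).
case=> B [[C oC <-] Ct] BA; apply: filterS BA _; exact: (h i).
Qed.

Lemma shift_cvg G (F : set_system (shift_space G cantor_space))
    (t : shift_space G cantor_space) : Filter F ->
  (forall g n, F [set x | x g n = t g n]) -> F --> t.
Proof.
move=> FF h; apply: prod_cvg => g B oB Bt.
pose Fg : set_system cantor_space := [set S | F [set x | S (x g)]].
have /(_ B) : Fg --> t g.
  apply: prod_cvg => n C _ Ct.
  by apply: (@filterS _ F _ _ _ _ (h g n)) => x /= ->.
by apply; exact: open_nbhs_nbhs.
Qed.

Lemma nbhs_bit (G : eqType) (x : shift_space G cantor_space) g n :
  nbhs x [set y : shift_space G cantor_space | y g n = x g n].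
Proof.
have nb : nbhs (x g) [set z : cantor_space | z n = x g n].
  apply: (@proj_continuous nat (fun _ => bool) n (x g) [set b | b = x g n]).
  by apply/principal_filterP.
exact: (@proj_continuous G (fun _ => cantor_space) g x _ nb).
Qed.

Definition finitely_determined (G : eqType) (h : (G -> nat -> bool) -> bool) :=
  exists l : seq (G * nat), forall x y,
    (forall c, c \in l -> x c.1 c.2 = y c.1 c.2) -> h x = h y.

Lemma finitely_determined_family (G E : eqType) (e : seq E)
    (k : E -> (G -> nat -> bool) -> bool) (h : (G -> nat -> bool) -> bool) :
  (forall a, finitely_determined (k a)) ->
  (forall x y, (forall a, a \in e -> k a x = k a y) -> h x = h y) ->
  finitely_determined h.
Proof.
move=> /choice[l hl] hk; exists (flatten [seq l a | a <- e]) => x y hxy.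
apply: hk => a ae; apply: hl => c cl; apply: hxy.
by apply/flattenP; exists (l a) => //; apply/mapP; exists a.
Qed.

Lemma continuous_bitwise (G : eqType) H
    (f : shift_space G cantor_space -> shift_space H cantor_space) :
  (forall w n, finitely_determined (fun x => f x w n)) -> continuous f.
Proof.
move=> fd x; apply: shift_cvg => w n; have [l hl] := fd w n.
have : nbhs x [set y : shift_space G cantor_space |
    forall c, c \in l -> y c.1 c.2 = x c.1 c.2].
  elim: l {hl} => [|c l IH]; first exact: filterS filterT.
  apply: filterS (filterI (nbhs_bit x c.1 c.2) IH) => y [e1 e2] d /=.
  by rewrite in_cons => /orP[/eqP ->//|]; exact: e2.
by apply: filterS => y e; exact: hl.
Qed.

Lemma borel_continuous (T U : topologicalType) (f : T -> U) :
  continuous f -> borel_fun f.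
Proof.
move=> /continuousP cf.
suff : borel (T := U) `<=` [set B | borel (f @^-1` B)] by [].
apply: smallest_sub; last first.
  by move=> O oO; apply: sub_gen_smallest; exact: cf.
have [s0 sC sU] := smallest_sigma_algebra (T := T) setT [set V | open V].
split=> /=.
- by rewrite preimage_set0.
- by move=> B bB; rewrite setTD preimage_setC -setTD; exact: sC.
- by move=> F bF; rewrite preimage_bigcup; exact: sU.
Qed.

(** * Words of a free product *)

Section RankRecursion.
Context {C : Type} (rank : C -> nat) (F : C -> (C -> bool) -> bool).

(** For a step that reads only smaller ranks, the values at ranks below [t] are final after [t]
    iterations. *)
Fixpoint rank_approx t : C -> bool :=
  if t is t'.+1 then fun c => F c (rank_approx t') else fun _ => false.

Definition rank_rec c := rank_approx (rank c).+1 c.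

Context (F_rank : forall c z z',
  (forall d, rank d < rank c -> z d = z' d) -> F c z = F c z').

Lemma rank_approxE t c : rank c < t -> rank_approx t c = rank_rec c.
Proof.
elim/ltn_ind: t c => -[|t] //= IH c; rewrite ltnS => hc.
by rewrite /rank_rec /=; apply: F_rank => d hd; rewrite !IH //; lia.
Qed.

Lemma rank_recE c : rank_rec c = F c rank_rec.
Proof.
by rewrite {1}/rank_rec /=; apply: F_rank => d; exact: rank_approxE.
Qed.

Lemma rank_rec_uniq y : (forall c, y c = F c y) -> y = rank_rec.
Proof.
move=> ey; apply: funext => c; have [n] := ubnP (rank c).
elim: n c => // n IH c hc; rewrite ey rank_recE; apply: F_rank => d hd.
by apply: IH; lia.
Qed.

End RankRecursion.

Section Words.
Local Open Scope group_scope.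
Context {I : choiceType} (G : I -> groupType) (idx : forall i, G i -> nat).
Local Notation letter := {i : I & G i}.
Local Notation P := (free_product G).
Local Notation Tg i := (Tagged (fun i => G i : Type) (i := i)).
Implicit Types (j : I) (p w : P).

Definition starts j p := if word p is a :: _ then tag a == j else false.

(** With [tl], the decomposition into right cosets of [G j]: [p] is uniquely [fp_in g * w] with [w]
    not starting in [G j]. *)
Definition hd j p : G j :=
  if word p is a :: _ then tagged_as (Tg j 1) a else 1.

Lemma tagged_as_neq (a b : letter) :
  tag a != tag b -> tagged_as a b = tagged a.
Proof.
by move=> ne; rewrite /tagged_as; case: eqP ne => // ->; rewrite eqxx.
Qed.

Lemma reduced_behead (a : letter) s : reduced (a :: s) -> reduced s.
Proof. by rewrite reduced_cons => /and3P[]. Qed.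

Lemma reduced_tl j p :
  reduced (if starts j p then behead (word p) else word p).
Proof.
case: p => -[|a s] r; rewrite /starts /=; first by [].
by case: ifP => _ //; exact: reduced_behead r.
Qed.

Definition tl j p : P := FreeProduct (reduced_tl j p).

Lemma tlN j p : ~~ starts j (tl j p).
Proof.
case: p => -[|a s] //= r; rewrite /starts /tl /= /starts /=.
case: ifPn => [/eqP ea|] //=.
case: s r => //= b s; rewrite reduced_cons => /and3P[_ + _].
by rewrite ea eq_sym.
Qed.

Lemma word_fp_in_mul j (g : G j) w : ~~ starts j w ->
  word (fp_in g * w) = if g == 1 then word w else Tg j g :: word w.
Proof.
case: w => s r; rewrite /starts /= => ns.
rewrite -[LHS]/(wmul (lmul (Tg j g) [::]) s) [lmul _ _]/lmul /=.
case: eqVneq => //= g1; rewrite /lmul /= (negbTE g1).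
by case: s r ns => //= b s _; rewrite eq_sym => /negbTE ->.
Qed.

Lemma hd_tl j p : fp_in (hd j p) * tl j p = p.
Proof.
apply: val_inj; rewrite /= -[wmul _ _]/(word (fp_in (hd j p) * tl j p)).
rewrite word_fp_in_mul ?tlN //.
case: p => -[|[i g] s] r; rewrite /hd /tl /starts /=; first by rewrite eqxx.
case: (eqVneq i j) => [ij|nij].
  subst j; rewrite tagged_asE.
  by move: r; rewrite reduced_cons => /andP[/negbTE /= -> _].
by rewrite tagged_as_neq /= ?eqxx // eq_sym.
Qed.

Lemma hd_mul j (g : G j) w : ~~ starts j w -> hd j (fp_in g * w) = g.
Proof.
move=> ns; rewrite /hd word_fp_in_mul //; case: (eqVneq g 1) => [->|_].
  case: w ns => -[|[i h] s] r //; rewrite /starts /= => nij.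
  by rewrite tagged_as_neq /= // eq_sym.
by rewrite tagged_asE.
Qed.

Lemma tl_mul j (g : G j) w : ~~ starts j w -> tl j (fp_in g * w) = w.
Proof.
move=> ns; apply: (@mulgI _ (fp_in g)).
by rewrite -{1}(hd_mul g ns) hd_tl.
Qed.

Lemma fp_in1 j : fp_in (1 : G j) = 1 :> P.
Proof. by apply: val_inj; rewrite /= /lmul /= eqxx. Qed.

Lemma tl_id j w : ~~ starts j w -> tl j w = w.
Proof. by move=> /(tl_mul 1); rewrite fp_in1 mul1g. Qed.

Lemma hd_id j w : ~~ starts j w -> hd j w = 1.
Proof. by move=> /(hd_mul 1); rewrite fp_in1 mul1g. Qed.

Lemma hd_shift j (g : G j) p : hd j (fp_in g * p) = g * hd j p.
Proof. by rewrite -{1}(hd_tl j p) mulgA -fp_inM hd_mul // tlN. Qed.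

Lemma tl_shift j (g : G j) p : tl j (fp_in g * p) = tl j p.
Proof. by rewrite -{1}(hd_tl j p) mulgA -fp_inM tl_mul // tlN. Qed.

Lemma startsE j p : starts j p = (hd j p != 1).
Proof.
apply/idP/idP => [|h]; last by apply: contraNT h => /hd_id ->.
case: p => -[|[i g] s] r; rewrite /starts /hd //= => /eqP ij; subst j.
by rewrite tagged_asE; move: r; rewrite reduced_cons => /andP[].
Qed.

Lemma starts_uniq i j p : starts i p -> starts j p -> i = j.
Proof. by rewrite /starts; case: (word p) => // a s /eqP -> /eqP. Qed.

Lemma starts1 j : starts j 1 = false.
Proof. by []. Qed.

(** The increment makes the weight drop strictly whenever a letter is removed. *)
Definition wt p := sumn [seq (idx (tagged a)).+1 | a <- word p].

Lemma wt_hd_tl j p : starts j p -> wt p = wt (tl j p) + (idx (hd j p)).+1.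
Proof.
rewrite startsE => h1; rewrite -{1}(hd_tl j p) /wt word_fp_in_mul ?tlN //.
by rewrite (negbTE h1) /= addnC.
Qed.

End Words.

(** * The game on a free product *)

Section MarksGame.
Local Open Scope group_scope.
Context {I : choiceType} (G : I -> groupType) (idx : forall i, G i -> nat).
Context (own : nat -> option I) (rk : nat -> nat -> nat).
Context (rk_lt : forall r r' n, r < r' -> rk r n < rk r' n).
Local Notation P := (free_product G).
Local Notation coord := (P * nat)%type.
Implicit Types (i j : I) (p w : P) (c : coord) (y : coord -> bool).

Definition rank c := rk (wt idx c.1) c.2.

Definition opp j c := starts j c.1 || ((c.1 == 1) && (own c.2 == Some j)).

(** At equal rank the opponent moves first, so he sees only bits of smaller rank. *)
Definition turn j c := if opp j c then (rank c).*2 else (rank c).*2.+1.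

Lemma odd_turn j c : odd (turn j c) = ~~ opp j c.
Proof. by rewrite /turn; case: opp; rewrite /= odd_double. Qed.

Lemma opp_uniq i j c : opp i c -> opp j c -> i = j.
Proof.
case/orP => [si|/andP[/eqP c1 /eqP oi]]; case/orP => [sj|/andP[c1' oj]].
- exact: starts_uniq si sj.
- by move: si; rewrite (eqP c1') starts1.
- by move: sj; rewrite c1 starts1.
- by move: oj; rewrite oi => /eqP[].
Qed.

Definition curry_bits y : shift_space P cantor_space := fun w n => y (w, n).

Lemma open_plays_curry j (O : set (shift_space P cantor_space)) : open O ->
  open_plays [set a : nat -> coord -> bool |
    O (curry_bits (fun c => a (turn j c) c))].
Proof.
move=> oO a Oz.
pose dec (b : nat -> coord -> bool) := curry_bits (fun c => b (turn j c) c).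
have {}Oz : O (dec a) := Oz.
pose F : set_system (shift_space P cantor_space) := [set S |
  exists n, forall b, pre b n = pre a n -> S (dec b)].
have FF : Filter F.
  split.
  - by exists 0.
  - move=> S T [n hn] [m hm]; exists (maxn n m) => b e; split.
      apply: hn; rewrite -(trunc_pre b (leq_maxl n m)) e.
      by rewrite trunc_pre // leq_maxl.
    apply: hm; rewrite -(trunc_pre b (leq_maxr n m)) e.
    by rewrite trunc_pre // leq_maxr.
  - by move=> S T ST [n hn]; exists n => b /hn; exact: ST.
have /(_ O) : F --> dec a.
  apply: shift_cvg => w n; exists (turn j (w, n)).+1 => b e.
  by rewrite /dec /curry_bits /= (pre_inj e (ltnSn _)).
by apply; exact: open_nbhs_nbhs.
Qed.

Lemma marks_game_determinacy j (A : set (shift_space P cantor_space)) :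
  borel A ->
  (exists s, forall y, plays_by (turn j) false s y -> ~ A (curry_bits y)) \/
  (exists s, forall y, plays_by (turn j) true s y -> A (curry_bits y)).
Proof.
move=> bA.
have uA := unravelable_borel (@open_plays_curry j) bA.
have := coordinate_determinacy (turn := turn j)
  (A := [set y | ~ A (curry_bits y)]) (unravelableC uA).
case=> [|[s hs]]; first by left.
by right; exists s => y /hs /contrapT.
Qed.

(* Should the opponent win every game, all these strategies can be played
   against one another: they own disjoint sets of coordinates. The resulting
   point is in no piece of the partition. *)
Lemma marks_game (A : I -> set (shift_space P cantor_space)) :
  (forall j, borel (A j)) -> \bigcup_j A j = setT ->
  exists j s, forall y, plays_by (turn j) true s y -> A j (curry_bits y).
Proof.
move=> bA cA; apply: contrapT => nj.
have lose j : exists t, forall y,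
    plays_by (turn j) false t y -> ~ A j (curry_bits y).
  have [//|[t ht]] := marks_game_determinacy j (bA j).
  by case: nj; exists j, t.
have [s hs] := choice lose.
(* By [opp_uniq] at most one strategy claims [c]; unclaimed bits are [false]. *)
pose F c z := if pselect (exists j, opp j c) is left e then
  s (sval (cid e)) c (below (turn (sval (cid e))) z (rank c).*2) else false.
have FE j c z : opp j c -> F c z = s j c (below (turn j) z (turn j c)).
  move=> oc; rewrite /F; case: pselect => [e|ne]; last by case: ne; exists j.
  case: cid => k /= ok; rewrite (opp_uniq ok oc); congr (s _ _ _).
  by rewrite /turn oc.
pose y := rank_rec rank F.
have yE c : y c = F c y.
  apply: rank_recE => {}c z z' h; rewrite /F; case: pselect => [e|//] /=.
  congr (s _ _ _); apply: funext => d; rewrite /below.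
  case: ltnP => hd; rewrite ?andbF // !andbT; apply: h.
  by move: hd; rewrite /turn; case: ifP; lia.
have : (\bigcup_j A j) (curry_bits y) by rewrite cA.
case=> j _; apply: (hs j) => c; rewrite odd_turn => /negbFE oc.
by rewrite {1}yE (FE j).
Qed.

Section Equivariant.
Context (j : I) (s : coord -> (coord -> bool) -> bool).
Implicit Types (v : G j -> nat -> bool) (g : G j).

Definition shift g y : coord -> bool := fun c => y (fp_in g * c.1, c.2).

Definition coded c := (tl j c.1 == 1) && (own c.2 == Some j).

(** The bit [(p, n)] is filled by the play translated by [hd j p], where it appears at
    [(tl j p, n)]; coded bits are available from the start. *)
Definition code_rank c := if coded c then 0 else (rank (tl j c.1, c.2)).+1.

Definition code_step v c y : bool :=
  if coded c then v (hd j c.1) c.2 else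
  s (tl j c.1, c.2) (below (turn j) (shift (hd j c.1) y)
                       (turn j (tl j c.1, c.2))).

(* Every translate of the point by an element of G j is a play according to s;
   these plays are the moves of the opponent in one another. *)
Definition equicode v := rank_rec code_rank (code_step v).

Lemma opp_tl c : ~~ coded c -> ~~ opp j (tl j c.1, c.2).
Proof. by rewrite /opp /coded (negbTE (tlN _ _)). Qed.

Lemma coded_shift g p n : coded (fp_in g * p, n) = coded (p, n).
Proof. by rewrite /coded /= tl_shift. Qed.

(** This makes the simultaneous plays well-founded: an opponent's bit seen at equal rank belongs to
    another translate, where its first letter is removed and its rank has dropped. *)
Lemma code_rank_turn c g d : ~~ coded c ->
  turn j d < turn j (tl j c.1, c.2) ->
  code_rank (fp_in g * d.1, d.2) < code_rank c.
Proof.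
move=> nc; rewrite {2}/turn (negbTE (opp_tl nc)) /code_rank (negbTE nc) => lt.
case: ifP => // /negbT; rewrite coded_shift tl_shift /= => nd.
rewrite -surjective_pairing in nd; rewrite ltnS.
move: lt; rewrite /turn; case: (boolP (starts j d.1)) => sd.
  rewrite /opp sd /= => lt; suff : rank (tl j d.1, d.2) < rank d by lia.
  by rewrite /rank /=; apply: rk_lt; rewrite (wt_hd_tl idx sd); lia.
have td : tl j d.1 = d.1 by rewrite tl_id.
have -> : opp j d = false.
  by rewrite /opp (negbTE sd) /=; move: nd; rewrite /coded td => /negbTE.
by rewrite td -surjective_pairing; lia.
Qed.

Lemma below_shift_eq c g y y' : ~~ coded c ->
  (forall d, turn j d < turn j (tl j c.1, c.2) ->
     y (fp_in g * d.1, d.2) = y' (fp_in g * d.1, d.2)) ->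
  below (turn j) (shift g y) (turn j (tl j c.1, c.2)) =
  below (turn j) (shift g y') (turn j (tl j c.1, c.2)).
Proof.
move=> nc h; apply: funext => d; rewrite /below /shift.
by case: ltnP => hd; rewrite ?andbF // h.
Qed.

Lemma code_step_rank v c z z' :
  (forall d, code_rank d < code_rank c -> z d = z' d) ->
  code_step v c z = code_step v c z'.
Proof.
move=> h; rewrite /code_step; case: ifPn => // nc; congr (s _ _).
by apply: below_shift_eq => // d hd; apply: h; exact: code_rank_turn.
Qed.

Lemma codeE v c : equicode v c = code_step v c (equicode v).
Proof. exact/rank_recE/code_step_rank. Qed.

Lemma code_coded v g n : own n = Some j -> equicode v (fp_in g, n) = v g n.
Proof.
move=> on; have ns : ~~ starts j (1 : P) by rewrite starts1.
have := tl_mul g ns; have := hd_mul g ns; rewrite mulg1 => hg tg.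
by rewrite codeE /code_step /coded /= tg hg on !eqxx.
Qed.

(** Both sides satisfy the same recursion, so [rank_rec_uniq] identifies them. *)
Lemma code_shift v g :
  equicode (fun h => v (g * h)) = shift g (equicode v).
Proof.
apply/esym; apply: rank_rec_uniq => [c z z'|c]; first exact: code_step_rank.
rewrite {1}/shift codeE /code_step coded_shift -surjective_pairing /=.
rewrite hd_shift tl_shift; case: ifP => // _; congr (s _ (below _ _ _)).
by apply: funext => d; rewrite /shift /= mulgA -fp_inM.
Qed.

Lemma code_plays v : plays_by (turn j) true s (equicode v).
Proof.
move=> [p n]; rewrite odd_turn => no; rewrite codeE /code_step /coded /=.
have nsp : ~~ starts j p by apply: contra no => sp; rewrite /opp sp.
rewrite tl_id // hd_id //; case: ifPn => [/andP[/eqP p1 on]|_].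
  by move: no; rewrite /opp p1 eqxx on orbT.
congr (s _ (below _ _ _)); apply: funext => d; rewrite /shift fp_in1 mul1g.
by case: d.
Qed.

Definition chain_prod (ch : seq (G j)) : G j := foldr (fun g h => g * h) 1 ch.
Definition chain_wt (ch : seq (G j)) := sumn [seq (idx g).+1 | g <- ch].

Context (rk_shift : forall r m r' n k,
  rk r m <= rk r' n -> rk (r + k) m <= rk (r' + k) n).

(* Each hop from a play to one of its translates costs the weight of the
   corresponding letter. *)
Lemma code_determined v v' c : ~~ coded c ->
  (forall ch m, own m = Some j ->
     rk (chain_wt ch) m <= rank (tl j c.1, c.2) ->
     v (hd j c.1 * chain_prod ch) m = v' (hd j c.1 * chain_prod ch) m) ->
  equicode v c = equicode v' c.
Proof.
have [k] := ubnP (code_rank c); elim: k c => // k IH c hk nc h.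
rewrite !codeE /code_step (negbTE nc); congr (s _ _).
apply: below_shift_eq => // d dt.
have rd := code_rank_turn (hd j c.1) nc dt.
have hr : rank d <= rank (tl j c.1, c.2).
  move: dt; rewrite {2}/turn (negbTE (opp_tl nc)) /turn; case: ifP; lia.
case: (boolP (coded d)) => cd.
  rewrite !codeE /code_step coded_shift -surjective_pairing cd /= hd_shift.
  move: (cd); rewrite /coded => /andP[t1 /eqP on].
  case: (boolP (starts j d.1)) => sd.
    have := h [:: hd j d.1] d.2 on; rewrite /= mulg1; apply.
    apply: leq_trans hr; rewrite /rank /= (wt_hd_tl idx sd) (eqP t1).
    by rewrite /chain_wt /= addn0.
  have := h [::] d.2 on; rewrite /= (hd_id sd); apply.
  apply: leq_trans hr; rewrite /rank /chain_wt /=.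
  by move: t1; rewrite tl_id // => /eqP ->.
apply: IH => /=; first exact: leq_trans rd hk.
  by rewrite coded_shift -surjective_pairing.
move=> ch m om; rewrite hd_shift tl_shift => hch.
case: (boolP (starts j d.1)) => sd; last first.
  rewrite (hd_id sd) mulg1; apply: h => //.
  by apply: leq_trans hch _; rewrite tl_id // -surjective_pairing.
rewrite -mulgA -[hd j d.1 * _]/(chain_prod (hd j d.1 :: ch)); apply: h => //.
apply: leq_trans hr; rewrite /rank /= (wt_hd_tl idx sd) /chain_wt /= addnC.
exact: rk_shift.
Qed.

End Equivariant.

End MarksGame.

(** * Making the embedding a reduction *)

Section Schedule.

Fixpoint chains t : seq (seq nat) := if t is t'.+1 then
  [::] :: [seq a :: ch | a <- iota 0 t, ch <- chains t'] else [:: [::]].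

Lemma mem_chains t ch : sumn [seq a.+1 | a <- ch] <= t -> ch \in chains t.
Proof.
elim: t ch => [|t IH] [|a ch] // h; rewrite /= in h.
have : a :: ch \in [seq a :: ch | a <- iota 0 t.+1, ch <- chains t].
  apply/allpairsP; exists (a, ch); split=> //.
    by rewrite mem_iota /=; lia.
  by apply: IH => /=; lia.
by move=> h'; rewrite inE; apply/orP; right.
Qed.

(* Stage i consists of cap i bits, enough to number all possible values of the
   bits listed in [visible i]. *)
Fixpoint cap i : nat := if i is i'.+1 then
  2 ^ (size (chains (2 * 3 ^ i)) * (i * cap i')) + cap i' else 1.

Definition visible i : seq (seq nat * (nat * nat)) :=
  [seq (ch, e) | ch <- chains (2 * 3 ^ i),
                 e <- [seq (i', k) | i' <- iota 0 i, k <- iota 0 (cap i.-1)]].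

Lemma cap_visible i : 2 ^ size (visible i) <= cap i.
Proof.
rewrite /visible !size_allpairs !size_iota; case: i => [|i].
  by rewrite mul0n muln0.
exact: leq_addr.
Qed.

Lemma cap_gt0 i : 0 < cap i.
Proof. by elim: i => //= i IH; rewrite addn_gt0 IH orbT. Qed.

Lemma leq_cap i i' : i <= i' -> cap i <= cap i'.
Proof.
move=> /subnK <-; elim: (i' - i) => // d IH.
by rewrite addSn; apply: leq_trans IH _; exact: leq_addl.
Qed.

Fixpoint time t : nat := if t is t'.+1 then time t' + cap t' else 0.

Lemma leq_time t t' : t <= t' -> time t <= time t'.
Proof.
move=> /subnK <-; elim: (t' - t) => // d IH.
by rewrite addSn; apply: leq_trans IH _; exact: leq_addr.
Qed.

Lemma time_lex t k t' k' : k < cap t -> k' < cap t' ->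
  (time t + k <= time t' + k') = (t < t') || (t == t') && (k <= k').
Proof.
move=> hk hk'; case: (ltngtP t t') => [lt|lt|->] /=; last by rewrite leq_add2l.
- have := leq_time lt => /=; lia.
- by apply/negbTE; rewrite -ltnNge; have := leq_time lt => /=; lia.
Qed.

Definition level n : nat * nat := odflt (0, 0) (unpickle n).
Definition stage n := (level n).1.
(** Offsets beyond the stage become 0, which keeps [off] below [cap] as [time_lex] requires. *)
Definition off n := if (level n).2 < cap (stage n) then (level n).2 else 0.

Lemma stage_pickle (i k : nat) : stage (pickle (i, k)) = i.
Proof. by rewrite /stage /level pickleK. Qed.

Lemma off_pickle (i k : nat) : k < cap i -> off (pickle (i, k)) = k.
Proof. by rewrite /off /stage /level pickleK /= => ->. Qed.

Lemma off_lt n : off n < cap (stage n).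
Proof. by rewrite /off; case: ifP => // _; exact: cap_gt0. Qed.

(** The lexicographic order on [(3 ^ stage n + r, off n)]. From stage [i], a word of weight at most
    [3 ^ i] sees no further than [2 * 3 ^ i], which is less than [3 ^ i.+1], where the next stage
    starts. *)
Definition rk r n := time (3 ^ stage n + r) + off n.

Lemma off_lt_cap n r : off n < cap (3 ^ stage n + r).
Proof.
apply: leq_trans (off_lt n) (leq_cap _).
by apply: leq_trans (ltnW (ltn_expl _ _)) (leq_addr _ _).
Qed.

Lemma rk_lex r m r' n : (rk r m <= rk r' n) =
  (3 ^ stage m + r < 3 ^ stage n + r') ||
  (3 ^ stage m + r == 3 ^ stage n + r') && (off m <= off n).
Proof. by rewrite time_lex ?off_lt_cap. Qed.

Lemma rk_lt r r' n : r < r' -> rk r n < rk r' n.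
Proof.
move=> h; rewrite ltnNge rk_lex negb_or ltn_add2l eqn_add2l.
by rewrite -leqNgt (ltnW h) negb_and neq_ltn h orbT.
Qed.

Lemma rk_shift r m r' n k : rk r m <= rk r' n -> rk (r + k) m <= rk (r' + k) n.
Proof. by rewrite !rk_lex !addnA ltn_add2r eqn_add2r. Qed.

Lemma rk_bound r m r' n : rk r m <= rk r' n ->
  3 ^ stage m + r <= 3 ^ stage n + r'.
Proof. by rewrite rk_lex; case/orP => [/ltnW|/andP[/eqP ->]]. Qed.

End Schedule.

Definition bits_num (s : seq bool) : nat :=
  foldr (fun (b : bool) n => b + n.*2) 0 s.

Lemma bits_num_lt s : bits_num s < 2 ^ size s.
Proof. by elim: s => //= b s IH; rewrite expnS; case: b; lia. Qed.

Lemma bits_num_inj s t : size s = size t -> bits_num s = bits_num t -> s = t.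
Proof.
elim: s t => [|b s IH] [|c t] //= [st] e.
have bc : b = c by case: b c e => -[] //; lia.
by rewrite bc (IH t) //; move: e; rewrite bc; lia.
Qed.

Lemma inj_unbounded (h : nat -> nat) r : injective h -> exists d, r <= h d.
Proof.
move=> hi; apply: contrapT => nd.
have lt d : h d < r by rewrite ltnNge; apply/negP => ?; apply: nd; exists d.
have hi' : injective (fun d : 'I_r.+1 => Ordinal (lt d)).
  by move=> d e /(congr1 val)/hi/val_inj.
by have := leq_card _ hi'; rewrite !card_ord ltnn.
Qed.

(** * The diagonal code and the embedding *)

Section Reduction.
Local Open Scope group_scope.
Context {I : choiceType} (G : I -> groupType) (num : I -> nat).
Context (idx : forall i, G i -> nat).
Context (num_inj : injective num).
Context (idx_inj : forall i, injective (@idx i)).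
Local Notation P := (free_product G).

(* The task at stage i: either to separate (when the word is nonempty), at the
   word coded by the second entry, the points satisfying a finite list of
   constraints, or to copy a bit. The first entry is the index of the owner; the
   last one makes every task recur. *)
Definition task i : (nat * seq (nat * nat)) * (seq (nat * nat * bool) * nat) :=
  odflt (0, [::], ([::], 0)) (unpickle i).

Lemma task_pickle t : task (pickle t) = t.
Proof. by rewrite /task pickleK. Qed.

Definition own n : option I :=
  if pselect (exists j, num j = (task (stage n)).1.1) is left e
  then Some (sval (cid e)) else None.

Lemma ownP n j : own n = Some j <-> num j = (task (stage n)).1.1.
Proof.
rewrite /own; case: pselect => [e|ne] /=; last first.
  by split=> // e; case: ne; exists j.
case: cid => k /= ek; split=> [[<-] //|ej]; congr Some.
by apply: num_inj; rewrite ek ej.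
Qed.

Definition word_code (p : P) : seq (nat * nat) :=
  [seq (num (tag a), idx (tagged a)) | a <- word p].

Lemma word_code_inj : injective word_code.
Proof.
move=> p q e; apply: val_inj => /=; apply: inj_map e => -[i g] [i' g'] /= [e].
by have ii := num_inj e; subst i' => /idx_inj ->.
Qed.

Definition word_of v : P := pick_such 1 (fun p => word_code p = v).

Lemma word_codeK : cancel word_code word_of.
Proof.
move=> p; apply: word_code_inj.
by apply: (@pick_suchP _ _ (fun q => word_code q = _)); exists p.
Qed.

Context (j : I) (s : P * nat -> (P * nat -> bool) -> bool).
Local Notation point := (G j -> nat -> bool).
Local Notation f := (@equicode I G idx own rk j s).
Local Notation wt := (wt idx).
Implicit Types (x y : point) (g h : G j) (K : point -> nat -> nat -> bool).

(** The shift by the inverse of [g]. *)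
Definition translate g x : point := fun h => x (g * h).

Lemma translateM g h x : translate h (translate g x) = translate (g * h) x.
Proof. by apply: funext => k; rewrite /translate mulgA. Qed.

Definition dec m : G j := pick_such 1 (fun g => idx g = m).

Lemma idxK : cancel (@idx j) dec.
Proof.
move=> g; apply: idx_inj.
by apply: (@pick_suchP _ _ (fun h => idx h = _)); exists g.
Qed.

Definition orbit_code K x : point :=
  fun g n => K (translate g x) (stage n) (off n).

Definition info K i x : seq bool :=
  [seq K (translate (chain_prod [seq dec a | a <- e.1]) x) e.2.1 e.2.2
     | e <- visible i].

Definition representative K i k : point :=
  pick_such (fun _ _ => false) (fun x => bits_num (info K i x) = k).

Definition satisfies (cs : seq (nat * nat * bool)) y :=
  all (fun t => y (dec t.1.1) t.1.2 == t.2) cs.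

(** The negation diagonalises against the [k]-th possible value of [info]; the factor [satisfies]
    makes bits of the current stage vanish at nearby translates. The empty word marks a copying
    task. *)
Definition kappa_bit K i y k : bool :=
  if (task i).1.2 is [::] then
    y (dec (level (task i).2.2).1) (level (task i).2.2).2
  else satisfies (task i).2.1 y &&
    ~~ f (orbit_code K (representative K i k))
         (word_of (task i).1.2, pickle (i, k)).

Fixpoint kappa_upto i : point -> nat -> nat -> bool :=
  if i is i'.+1 then fun y e k =>
    if e == i' then kappa_bit (kappa_upto i') i' y k else kappa_upto i' y e k
  else fun _ _ _ => false.

Definition kappa y i k := kappa_bit (kappa_upto i) i y k.

Lemma kappa_uptoE i y e k : kappa_upto i y e k = (e < i) && kappa y e k.
Proof.
elim: i => //= i IH; rewrite ltnS leq_eqVlt; case: eqP => [->//|_] /=.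
exact: IH.
Qed.

Lemma kappa_copy y g m i : task i = (num j, [::], ([::], pickle (idx g, m))) ->
  kappa y i 0 = y g m.
Proof.
by move=> ti; rewrite /kappa /kappa_bit ti /= /level pickleK /= idxK.
Qed.

(** Every bit of a point is copied at some stage owned by [j]. *)
Lemma kappa_inj y y' :
  (forall n, own n = Some j ->
     kappa y (stage n) (off n) = kappa y' (stage n) (off n)) -> y = y'.
Proof.
move=> e; apply: funext => g; apply: funext => m.
pose i := pickle (num j, [::] : seq (nat * nat),
  ([::] : seq (nat * nat * bool), pickle (idx g, m))).
have := e (pickle (i, 0)); rewrite stage_pickle off_pickle ?cap_gt0 //.
rewrite !(@kappa_copy _ g m) ?task_pickle //; apply.
by apply/ownP; rewrite stage_pickle task_pickle.
Qed.

Lemma separating_constraints y (gs : seq (G j)) x :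
  (forall g, y <> translate g x) ->
  exists cs, satisfies cs y /\ forall g, g \in gs ->
    satisfies cs (translate g x) = false.
Proof.
move=> ne; elim: gs => [|g gs [cs [sy sx]]]; first by exists [::].
have [h [m hm]] : exists h m, y h m <> translate g x h m.
  apply: contrapT => nh; apply: (ne g); apply: funext => h; apply: funext => m.
  by apply: contrapT => hm; apply: nh; exists h, m.
exists ((idx h, m, y h m) :: cs); rewrite /satisfies /= idxK eqxx; split=> //.
move=> g'; rewrite in_cons => /orP[/eqP ->|/sx]; last first.
  by rewrite /satisfies => ->; rewrite andbF.
by case: eqP => // e; case: hm.
Qed.

Lemma map_dec_idx (ch : seq (G j)) :
  [seq dec a | a <- [seq idx g | g <- ch]] = ch.
Proof. by rewrite -map_comp (eq_map idxK) map_id. Qed.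

Lemma chain_wtE (ch : seq (G j)) :
  sumn [seq a.+1 | a <- [seq idx g | g <- ch]] = chain_wt idx ch.
Proof. by rewrite -map_comp. Qed.

(* A word w <> 1 outside of G j carries the code of y only if y is a translate
   of x: at a stage with task (j, w, cs) where cs separates y from the nearby
   translates of x, the bits of the code of x visible from w are those of
   earlier stages, hence shared with the representative of x. *)
Lemma kappa_separates x y w : ~~ starts j w -> w != 1 ->
  (forall n, own n = Some j ->
     f (orbit_code kappa x) (w, n) = kappa y (stage n) (off n)) ->
  exists g, y = translate g x.
Proof.
move=> sw w1 e; apply: contrapT => ne.
have ne' g : y <> translate g x by move=> yg; apply: ne; exists g.
pose near_ := [seq chain_prod [seq dec a | a <- ch] | ch <- chains (wt w)].
have [cs [sy sx]] := separating_constraints near_ ne'.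
pose t (d : nat) := (num j, word_code w, (cs, d)).
(* The task recurs for all [d], so its stage can be taken large against [wt w]. *)
have [d hwd] : exists d, wt w <= pickle (t d).
  by apply: inj_unbounded => d d' /(pcan_inj pickleK)[].
pose i := pickle (t d); have ti : task i = t d by rewrite task_pickle.
have wi : wt w <= 3 ^ i := leq_trans hwd (ltnW (ltn_expl i (isT : 1 < 3))).
pose K := kappa_upto i; pose k := bits_num (info K i x).
have kc : k < cap i.
  apply: leq_trans (cap_visible i); rewrite /k.
  by rewrite -(size_map (fun e => K (translate (chain_prod
       [seq dec a | a <- e.1]) x) e.2.1 e.2.2)) bits_num_lt.
pose n := pickle (i, k); pose x' := representative K i k.
have sn : stage n = i by rewrite stage_pickle.
have on : off n = k by rewrite off_pickle.
have ix : info K i x' = info K i x.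
  apply: bits_num_inj; first by rewrite !size_map.
  by apply: (@pick_suchP _ _ (fun z => bits_num (info K i z) = k)); exists x.
have wc : word_code w <> [::].
  move=> wc; case/eqP: w1; apply: word_code_inj; by rewrite wc.
have yk : kappa y i k = ~~ f (orbit_code K x') (w, n).
  rewrite /kappa /kappa_bit ti /= sy /= word_codeK.
  by case: word_code wc.
have own_n : own n = Some j by apply/ownP; rewrite sn ti.
have := e n own_n; rewrite sn on yk.
suff -> : f (orbit_code kappa x) (w, n) = f (orbit_code K x') (w, n).
  by case: f.
have rl r r' l : r < r' -> rk r l < rk r' l by exact: rk_lt.
have tw : tl j w = w := tl_id sw.
apply: (code_determined rl); first exact: rk_shift.
  by rewrite /coded /= tw (negbTE w1).
move=> ch m om; rewrite /rank /= tw (hd_id sw) mul1g => hr.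
have hb := rk_bound hr; rewrite sn in hb.
rewrite /orbit_code /K kappa_uptoE.
have gE : chain_prod ch = chain_prod [seq dec a | a <- [seq idx g | g <- ch]].
  by rewrite map_dec_idx.
(* Earlier stages are listed in [info]; later ones start beyond the bound [hb]; at stage [i] the
   constraints [cs] fail on the translates within reach, while [K] is zero there. *)
case: (ltngtP (stage m) i) => [lt|gt|eq] /=.
- pose v := ([seq idx g | g <- ch], (stage m, off m)).
  have vi : v \in visible i.
    apply/allpairsP; exists v; split=> //=.
      by apply: mem_chains; rewrite chain_wtE; lia.
    apply/allpairsP; exists (stage m, off m); rewrite !mem_iota /=; split=> //.
    by apply: leq_trans (off_lt m) (leq_cap _); lia.
  move: ix; rewrite /info => /eq_in_map/(_ v vi) /=.
  by rewrite /K map_dec_idx !kappa_uptoE lt /= => ->.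
- have : 3 ^ i.+1 <= 3 ^ stage m by rewrite leq_exp2l.
  by rewrite expnS; lia.
- rewrite eq /kappa /kappa_bit ti /=.
  case: word_code wc => [//|a v] _ /=; rewrite gE sx //.
  apply/mapP; exists [seq idx g | g <- ch] => //.
  by apply: mem_chains; rewrite chain_wtE; move: hb; rewrite eq leq_add2l.
Qed.

Definition embed x : shift_space P cantor_space :=
  curry_bits (f (orbit_code kappa x)).

Lemma orbit_code_translate g x :
  orbit_code kappa (translate g x) = fun h => orbit_code kappa x (g * h).
Proof. by apply: funext => h; rewrite /orbit_code translateM. Qed.

Lemma embed_translate g x w : embed (translate g x) w = embed x (fp_in g * w).
Proof.
apply: funext => n; rewrite /embed /curry_bits orbit_code_translate.
by rewrite code_shift //; exact: rk_lt.
Qed.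

Lemma embed_own x g n : own n = Some j ->
  embed x (fp_in g) n = kappa (translate g x) (stage n) (off n).
Proof.
by move=> on; rewrite /embed /curry_bits code_coded //; exact: rk_lt.
Qed.

Lemma translate1 x : translate 1 x = x.
Proof. by apply: funext => h; rewrite /translate mul1g. Qed.

Lemma embed_inj : injective embed.
Proof.
move=> x y e; apply: kappa_inj => n on.
by rewrite -[x]translate1 -[y]translate1 -!embed_own // e.
Qed.

(** Splitting [p] along [G j]: a trivial tail is settled by injectivity, and to a nontrivial one
    [kappa_separates] applies. *)
Lemma embed_reduction x y p : (forall w, embed y w = embed x (p * w)) ->
  exists g, y = translate g x.
Proof.
move=> e; rewrite -(hd_tl j p) in e.
case: (eqVneq (tl j p) 1) e => [->|t1] e.
  exists (hd j p); apply: embed_inj; apply: funext => w.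
  by rewrite e embed_translate mulg1.
have [|g ->] := @kappa_separates (translate (hd j p) x) y (tl j p) (tlN j p) t1.
  move=> n on; have := e 1; rewrite mulg1 -embed_translate => e1.
  rewrite -[LHS]/(embed (translate (hd j p) x) (tl j p) n) -e1.
  by rewrite -(fp_in1 G j) embed_own // translate1.
by exists (hd j p * g); rewrite translateM.
Qed.

Lemma kappa_determined i k : finitely_determined (fun y => kappa y i k).
Proof.
rewrite /kappa /kappa_bit; case: (task i).1.2 => [|a v].
  set g := dec _; set m := (level _).2; exists [:: (g, m)] => x y h.
  by apply: (h (g, m)); rewrite inE.
set b := ~~ _; set cs := (task i).2.1.
exists [seq (dec t.1.1, t.1.2) | t <- cs] => x y h; congr (_ && b).
apply: eq_in_all => t tc; rewrite (h (dec t.1.1, t.1.2)) //.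
by apply/mapP; exists t.
Qed.

Lemma kappa_translate_determined g i k :
  finitely_determined (fun y => kappa (translate g y) i k).
Proof.
have [l hl] := kappa_determined i k.
exists [seq (g * c.1, c.2) | c <- l] => x y h; apply: hl => c cl.
by apply: (h (g * c.1, c.2)); apply/mapP; exists c.
Qed.

Lemma embed_determined w n : finitely_determined (fun x => embed x w n).
Proof.
have rl r r' m : r < r' -> rk r m < rk r' m by exact: rk_lt.
rewrite /embed /curry_bits; case: (boolP (coded own j (w, n))) => cd.
  have [l hl] := kappa_translate_determined (hd j w) (stage n) (off n).
  exists l => x y h; rewrite !(codeE idx own rl) /code_step cd /=; exact: hl.
(* [rk_bound] confines the stages and chain weights that matter to at most [B], hence the bits read
   to the finite list [E]. *)
pose B := 3 ^ stage n + wt (tl j w).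
pose E := [seq (ch, e) | ch <- chains B,
   e <- [seq (i', k) | i' <- iota 0 B.+1, k <- iota 0 (cap B)]].
apply: (@finitely_determined_family _ _ E (fun e x =>
    kappa (translate (hd j w * chain_prod [seq dec a | a <- e.1]) x)
      e.2.1 e.2.2)) => [e|x y h]; first exact: kappa_translate_determined.
apply: (code_determined rl) => //; first exact: rk_shift.
move=> ch m om; rewrite /rank /= => /rk_bound hb.
have sm : stage m <= B.
  have := ltn_expl (stage m) (isT : 1 < 3); rewrite /B; lia.
have vE : ([seq idx g | g <- ch], (stage m, off m)) \in E.
  apply/allpairsP; exists ([seq idx g | g <- ch], (stage m, off m)).
  split=> //; first by apply: mem_chains; rewrite chain_wtE /B; lia.
  apply/allpairsP; exists (stage m, off m); rewrite !mem_iota; split=> //.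
  exact: leq_trans (off_lt m) (leq_cap sm).
by have := h _ vE; rewrite /= map_dec_idx.
Qed.

End Reduction.

Theorem theorem1p1 (I : set nat)
    (hI : I = [set: nat] \/ exists n : nat, I = `I_n)
    (Gamma : I -> groupType)
    (hGamma : forall i : I, countable [set: Gamma i])
    (A : I -> set (shift_space (free_product Gamma) cantor_space))
    (hA : borel_partition A) :
  exists (j : I)
    (f : shift_space (Gamma j) cantor_space ->
         shift_space (free_product Gamma) cantor_space),
    [/\ injective f,
        continuous f,
        forall (g : Gamma j) (x : shift_space (Gamma j) cantor_space),
          f (lshift_act g x) = lshift_act (fp_in g) (f x),
        range f `<=` A j &
        borel_reduction (@shift_orbit_rel (Gamma j) cantor_space)
          (@shift_orbit_rel (free_product Gamma) cantor_space) f].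
Proof.
have [bA _ cA] := hA.
have cinj i : exists h : Gamma i -> nat, injective h.
  have /countable_injP[h hi] := hGamma i; exists h => x y.
  by apply: hi; rewrite inE.
pose idx i := sval (cid (cinj i)).
have idx_inj i : injective (idx i) by exact: (svalP (cid (cinj i))).
pose num (i : I) : nat := val i.
have num_inj : injective num by exact: val_inj.
have rl r r' n : r < r' -> rk r n < rk r' n by exact: rk_lt.
have [j [s hs]] := marks_game idx (own num) rk bA cA.
pose f : shift_space (Gamma j) cantor_space ->
  shift_space (free_product Gamma) cantor_space := embed num idx s.
have fE (g : Gamma j) x :
    f (lshift_act g x) = lshift_act (fp_in g) (f x).
  apply: funext => w; rewrite [LHS](embed_translate num idx s g^-1%g).
  congr (embed _ _ _ _ (_ * _)%g).
  by apply: (@mulgI _ (fp_in g)); rewrite -fp_inM !mulgV fp_in1.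
have finj : injective f by exact: embed_inj.
have fcont : continuous f.
  apply: (@continuous_bitwise (Gamma j) (free_product Gamma) f) => w n.
  exact: embed_determined.
exists j, f; split=> //.
(* By [code_plays] each value of [f] is a play according to the winning strategy [s]. *)
- move=> _ [x _ <-]; apply: hs; exact: code_plays.
- split; first exact: borel_continuous.
  move=> x y; split=> [[g <-]|[p e]]; first by exists (fp_in g); rewrite fE.
  have [|g ->] := @embed_reduction _ _ _ _ num_inj idx_inj j s x y p^-1%g.
    by move=> w; rewrite -[LHS]/(f y w) -e.
  exists g^-1%g; apply: funext => h.
  by rewrite /lshift_act /translate invgK.
Qed.
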